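(* Let $X$ be an infinite-dimensional complex Banach space and $T\in L(X)$. (1) If $\sigma_p(T)\subset\partial\sigma_p(T)$, then $\sigma_{LD}(T)=\sigma_{TUD}(T)$. (2) If $\sigma_{cp}(T)\subset\partial\sigma_{cp}(T)$, then $\sigma_{dsc}(T)=\sigma_{TUD}(T)$ and $\sigma_{RD}(T)=\sigma_{q\Phi}(T)$. (3) If $\sigma_*(T)=\partial\sigma_*(T)$, where $\sigma_*\in\{\sigma_D,\sigma_{LD},\sigma_{LD}^e,\sigma_{B\Phi},\sigma_{B\mathcal{W}_+},\sigma_{B\mathcal{W}}\}$, then $\sigma_*(T)=\sigma_{TUD}(T)$. (4) If $\sigma_{dsc}(T)=\partial\sigma_{dsc}(T)$, then $\sigma_{dsc}(T)=\sigma_{TUD}(T)$ and $\sigma_{RD}(T)=\sigma_{q\Phi}(T)$. (5) If $\sigma_{dsc}^e(T)=\partial\sigma_{dsc}^e(T)$, then $\sigma_{dsc}^e(T)=\sigma_{TUD}(T)$ and $\sigma_{RD}^e(T)=\sigma_{q\Phi}(T)$. (6) If $\sigma_{B\mathcal{W}_-}(T)=\partial\sigma_{B\mathcal{W}_-}(T)$, then $\sigma_{B\mathcal{W}_-}(T)=\sigma_{q\Phi}(T)$.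
   Context: $L(X)$ is the algebra of bounded linear operators on $X$; $N(T)$, $R(T)$ are the null space and range; $\alpha(T)=\dim N(T)$, $\beta(T)=\operatorname{codim}R(T)$; $\mathbb{N}_0=\{0,1,2,\dots\}$; $\inf\emptyset=\infty$; $\partial K$ is the boundary of $K\subset\mathbb{C}$. $\sigma_p(T)$ is the point spectrum; the compression spectrum $\sigma_{cp}(T)$ is the set of $\lambda\in\mathbb{C}$ such that $T-\lambda I$ does not have dense range. Ascent $a(T)=\inf\{n\in\mathbb{N}_0:N(T^n)=N(T^{n+1})\}$; descent $\delta(T)=\inf\{n\in\mathbb{N}_0:R(T^n)=R(T^{n+1})\}$; essential ascent $a_e(T)=\inf\{n\in\mathbb{N}_0:\dim N(T^{n+1})/N(T^n)<\infty\}$; essential descent $\delta_e(T)=\inf\{n\in\mathbb{N}_0:\dim R(T^n)/R(T^{n+1})<\infty\}$. $T$ is left Drazin invertible if $a(T)<\infty$ and $R(T^{a(T)+1})$ is closed; right Drazin invertible if $\delta(T)<\infty$ and $R(T^{\delta(T)})$ is closed; Drazin invertible if $a(T)<\infty$ and $\delta(T)<\infty$; left essentially Drazin invertible if $a_e(T)<\infty$ and $R(T^{a_e(T)+1})$ is closed; right essentially Drazin invertible if $\delta_e(T)<\infty$ and $R(T^{\delta_e(T)})$ is closed. The corresponding spectra (sets of $\lambda\in\mathbb{C}$ for which $T-\lambda I$ fails the property) are $\sigma_{LD}(T),\sigma_{RD}(T),\sigma_D(T),\sigma_{LD}^e(T),\sigma_{RD}^e(T)$. Also $\sigma_{dsc}(T)=\{\lambda:\delta(T-\lambda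 I)=\infty\}$, $\sigma_{dsc}^e(T)=\{\lambda:\delta_e(T-\lambda I)=\infty\}$. An operator $S$ on a complex Banach space is upper semi-Fredholm if $\alpha(S)<\infty$ and $R(S)$ is closed, lower semi-Fredholm if $\beta(S)<\infty$, Fredholm if both; $\operatorname{ind}(S)=\alpha(S)-\beta(S)$. Let $T_n$ be the restriction of $T$ to $R(T^n)$ as a map $R(T^n)\to R(T^n)$. $T$ is B-Fredholm (resp. upper, lower semi-B-Fredholm) if for some $n\in\mathbb{N}_0$, $R(T^n)$ is closed and $T_n$ is Fredholm (resp. upper, lower semi-Fredholm); then $\operatorname{ind}(T):=\operatorname{ind}(T_n)$, independent of such $n$. $T$ is B-Weyl if it is B-Fredholm with $\operatorname{ind}(T)=0$; upper semi-B-Weyl if upper semi-B-Fredholm with $\operatorname{ind}(T)\le0$; lower semi-B-Weyl if lower semi-B-Fredholm with $\operatorname{ind}(T)\ge0$. The spectra for B-Fredholm, B-Weyl, upper semi-B-Weyl, lower semi-B-Weyl operators are $\sigma_{B\Phi}(T),\sigma_{B\mathcal{W}}(T),\sigma_{B\mathcal{W}_+}(T),\sigma_{B\mathcal{W}_-}(T)$. Let $k_n(T)=\dim (R(T^n)\cap N(T))/(R(T^{n+1})\cap N(T))$. $T$ is quasi-Fredholm if there is $d\in\mathbb{N}_0$ with $k_n(T)=0$ for all $n\ge d$ and $R(T^{d+1})$ closed. $T$ has topological uniform descent (TUD) if there is $d\in\mathbb{N}_0$ with $k_n(T)=0$ for all $n\ge d$ and, for all $n\ge d$, $R(T^n)$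 closed in $R(T^d)$ with respect to the norm $\|y\|_d=\inf\{\|x\|:x\in X,\ y=T^dx\}$. The sets of $\lambda$ for which $T-\lambda I$ is not quasi-Fredholm, does not have TUD are $\sigma_{q\Phi}(T),\sigma_{TUD}(T)$. *)

(* Defs.v *)
From mathcomp Require Import all_boot all_order all_algebra.
From mathcomp Require Import complex.
From mathcomp Require Import all_classical all_reals all_analysis.

Set Implicit Arguments.
Unset Strict Implicit.
Unset Printing Implicit Defensive.

Import Order.TTheory GRing.Theory Num.Theory.
Import numFieldNormedType.Exports.

Local Open Scope classical_set_scope.
Local Open Scope ring_scope.

(* [K] is a [numFieldType] so that on [R[i]] this is the topology of the
   modulus, which has no canonical instance keyed on [complex]. *)
Definition boundary (K : numFieldType) (A : set K) : set K :=
  closure A `\` interior A.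

(* Infimum in [0, +oo]; the infimum of the empty set is [+oo]. *)
Definition nat_inf (R : realType) (P : set nat) : \bar R :=
  ereal_inf [set n%:R%:E | n in P].

Section Operators.
Variables (R : realType) (X : completeNormedModType R[i]).
Implicit Types (V W M : set X) (S T : X -> X) (n d : nat) (l : R[i]).

Definition bounded_operator T : Prop :=
  exists C : R[i], forall x, `|T x| <= C * `|x|.

Definition null_space T : set X := [set x | T x = 0].

(* The family [v] represents a basis of V / W. *)
Definition quotient_basis V W n (v : 'I_n -> X) : Prop :=
  (forall i, V (v i)) /\
  (forall x, V x -> exists! c : 'rV[R[i]]_n, W (x - \sum_i c 0 i *: v i)).

(* dim V / W, equal to [+oo] when V / W has no finite basis. *)
Definition quotient_dim V W : \bar R :=
  nat_inf R [set n | exists v : 'I_n -> X, quotient_basis V W v].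

Definition dim V : \bar R := quotient_dim V [set 0].

Definition infinite_dimensional : Prop := dim setT = +oo%E.

Definition ascent T : \bar R :=
  nat_inf R [set n | null_space (iter n T) = null_space (iter n.+1 T)].

Definition descent T : \bar R :=
  nat_inf R [set n | range (iter n T) = range (iter n.+1 T)].

Definition ess_ascent T : \bar R :=
  nat_inf R [set n |
    (quotient_dim (null_space (iter n.+1 T)) (null_space (iter n T)) < +oo)%E].

Definition ess_descent T : \bar R :=
  nat_inf R [set n |
    (quotient_dim (range (iter n T)) (range (iter n.+1 T)) < +oo)%E].

Definition left_Drazin T : Prop :=
  exists n, ascent T = n%:R%:E /\ closed (range (iter n.+1 T)).

Definition right_Drazin T : Prop :=
  exists n, descent T = n%:R%:E /\ closed (range (iter n T)).

Definition Drazin T : Prop :=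
  (ascent T < +oo)%E /\ (descent T < +oo)%E.

Definition left_ess_Drazin T : Prop :=
  exists n, ess_ascent T = n%:R%:E /\ closed (range (iter n.+1 T)).

Definition right_ess_Drazin T : Prop :=
  exists n, ess_descent T = n%:R%:E /\ closed (range (iter n T)).

(* The restriction of S to an invariant subspace M, as a map M -> M. It is
   used only with M closed in X, so that M is a Banach space and being closed
   in M is the same as being closed in X. *)
Definition nullity_on M S : \bar R := dim (null_space S `&` M).

Definition deficiency_on M S : \bar R := quotient_dim M (S @` M).

Definition upper_semi_Fredholm_on M S : Prop :=
  (nullity_on M S < +oo)%E /\ closed (S @` M).

Definition lower_semi_Fredholm_on M S : Prop :=
  (deficiency_on M S < +oo)%E.

Definition Fredholm_on M S : Prop :=
  upper_semi_Fredholm_on M S /\ lower_semi_Fredholm_on M S.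

(* Meaningful when at least one of the two terms is finite. *)
Definition index_on M S : \bar R := (nullity_on M S - deficiency_on M S)%E.

Definition upper_semi_BFredholm_at T n : Prop :=
  closed (range (iter n T)) /\ upper_semi_Fredholm_on (range (iter n T)) T.

Definition lower_semi_BFredholm_at T n : Prop :=
  closed (range (iter n T)) /\ lower_semi_Fredholm_on (range (iter n T)) T.

Definition BFredholm_at T n : Prop :=
  closed (range (iter n T)) /\ Fredholm_on (range (iter n T)) T.

Definition upper_semi_BFredholm T : Prop :=
  exists n, upper_semi_BFredholm_at T n.

Definition lower_semi_BFredholm T : Prop :=
  exists n, lower_semi_BFredholm_at T n.

Definition BFredholm T : Prop := exists n, BFredholm_at T n.

(* The index of T restricted to R(T^n), for any n at which this restriction is
   semi-Fredholm; it does not depend on n. *)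
Definition Bindex T : \bar R :=
  let n := xget 0%N
    [set n | upper_semi_BFredholm_at T n \/ lower_semi_BFredholm_at T n] in
  index_on (range (iter n T)) T.

Definition BWeyl T : Prop := BFredholm T /\ Bindex T = 0%E.

Definition upper_semi_BWeyl T : Prop :=
  upper_semi_BFredholm T /\ (Bindex T <= 0)%E.

Definition lower_semi_BWeyl T : Prop :=
  lower_semi_BFredholm T /\ (0 <= Bindex T)%E.

Definition k_ T n : \bar R :=
  quotient_dim (range (iter n T) `&` null_space T)
               (range (iter n.+1 T) `&` null_space T).

Definition quasi_Fredholm T : Prop :=
  exists d, (forall n, (d <= n)%N -> k_ T n = 0%E) /\
            closed (range (iter d.+1 T)).

(* The norm of X is real but takes its values in [R[i]], hence [complex.Re]. *)
Definition range_norm T d (y : X) : R :=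
  inf [set complex.Re `|x| | x in [set x | y = iter d T x]].

(* A is closed in R(T^d) for the metric given by [range_norm T d]. *)
Definition range_norm_closed T d (A : set X) : Prop :=
  forall y, range (iter d T) y ->
    (forall e : R, 0 < e ->
       exists z, [/\ A z, range (iter d T) z & range_norm T d (y - z) < e]) ->
    A y.

Definition topological_uniform_descent T : Prop :=
  exists d, (forall n, (d <= n)%N -> k_ T n = 0%E) /\
            (forall n, (d <= n)%N -> range_norm_closed T d (range (iter n T))).

Definition shift T l : X -> X := fun x => T x - l *: x.

Definition spectrum_for (P : (X -> X) -> Prop) T : set R[i] :=
  [set l | ~ P (shift T l)].

Definition sigma_p T : set R[i] :=
  [set l | null_space (shift T l) <> [set 0]].
Definition sigma_cp T : set R[i] := [set l | ~ dense (range (shift T l))].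
Definition sigma_LD := spectrum_for left_Drazin.
Definition sigma_RD := spectrum_for right_Drazin.
Definition sigma_D := spectrum_for Drazin.
Definition sigma_LDe := spectrum_for left_ess_Drazin.
Definition sigma_RDe := spectrum_for right_ess_Drazin.
Definition sigma_dsc T : set R[i] := [set l | descent (shift T l) = +oo%E].
Definition sigma_dsce T : set R[i] :=
  [set l | ess_descent (shift T l) = +oo%E].
Definition sigma_BPhi := spectrum_for BFredholm.
Definition sigma_BW := spectrum_for BWeyl.
Definition sigma_BWplus := spectrum_for upper_semi_BWeyl.
Definition sigma_BWminus := spectrum_for lower_semi_BWeyl.
Definition sigma_qPhi := spectrum_for quasi_Fredholm.
Definition sigma_TUD := spectrum_for topological_uniform_descent.

End Operators.

Arguments infinite_dimensional {R} X.

(* Main.v *)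
Require Import Defs.
From mathcomp Require Import all_boot all_order all_algebra.
From mathcomp Require Import complex ring lra.
From mathcomp Require Import all_classical all_reals all_analysis.
Import Order.TTheory GRing.Theory Num.Theory.
Import numFieldNormedType.Exports.
Local Open Scope classical_set_scope.
Local Open Scope ring_scope.

Set Implicit Arguments.
Unset Strict Implicit.
Unset Printing Implicit Defensive.

(** Fix an operator [S] with uniform descent from [d] on, and put
    [K = N(S^d)]. On the Banach space [X / K], which [S^d] identifies with
    [R(S^d)], the operator induced by [S] has closed range and a kernel contained
    in the range of each of its powers. Such an operator has a punctured
    neighbourhood theorem ([local_constancy]): for all small [a <> 0] the operator
    [S - a] has closed range, its kernel lies in all the ranges [R((S - a)^n)],
    and at every power it has the nullity [dim N(S) `&` R(S^d)] and the defect
    [dim R(S^d) / R(S^(d+1))], finite or not.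

    This gives the theorem. Every property of [S] in question is governed by
    these two numbers: finite or zero nullity means finite essential ascent or
    ascent, finite or zero defect means finite essential descent or descent, and
    their difference is the index. If [l] belongs to a spectrum made of boundary
    points, then arbitrarily close to [l] there are points outside it. Were [l]
    outside the spectrum of uniform descent, the two numbers would pass from
    such a point to [T - l], and with them the property that [T - l] lacks. For
    the point and compression spectra it is injectivity and density of the range
    that pass. Conversely each property implies uniform descent: a finite
    nullity or defect takes its least value from some power on, after which all
    [k_n] vanish, and finite-dimensional corrections do not affect closedness of
    ranges.

    The proof of local constancy stays in [X], and treats [S - a] modulo [K]. The
    open mapping theorem bounds the solutions of [S x = y] modulo [K]. On the
    core [Rinf], the intersection of all [N(S^d) + R(S^j)], the operator is onto
    and stays so, with a uniform bound, after a small perturbation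
    ([core_bound]). Hence kernels move continuously in [a] for the gap; comparing
    kernels, the openness bound extends from the core to the full range
    ([ran_bound]), so that ranges are closed and move continuously as well. A
    small enough gap preserves the statement that a quotient has dimension at
    least [m] ([gap_dimge]). How small depends on [m], but the modulus of
    continuity is uniform on a disc, so a finite chain of steps reaches every
    point of the disc from its centre ([small_steps]), for each [m]. In this way
    infinite dimensions are covered as well.

    Dimensions are counted by flags, and closed linear relations replace
    quotient spaces, restrictions to subspaces and sums of ranges. *)

Local Notation shift := Defs.shift.

(** * Linear identities *)

Section LinearExpressions.
Variables (K : comNzRingType) (V : lmodType K).

Inductive lexp :=
  | LVar of nat | LZero | LAdd of lexp & lexp | LOpp of lexp | LScale of K & lexp.

Fixpoint leval (env : seq V) (e : lexp) : V :=
  match e with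
  | LVar n => env`_n
  | LZero => 0
  | LAdd a b => leval env a + leval env b
  | LOpp a => - leval env a
  | LScale k a => k *: leval env a
  end.

Fixpoint lcoef (e : lexp) (i : nat) : K :=
  match e with
  | LVar n => if Nat.eqb n i then 1 else 0
  | LZero => 0
  | LAdd a b => lcoef a i + lcoef b i
  | LOpp a => - lcoef a i
  | LScale k a => k * lcoef a i
  end.

Fixpoint lcoef_eq (n : nat) (e1 e2 : lexp) : Prop :=
  match n with
  | 0%N => True
  | n'.+1 => lcoef e1 n' = lcoef e2 n' /\ lcoef_eq n' e1 e2
  end.

Lemma leval_coef (env : seq V) e :
  leval env e = \sum_(i < size env) lcoef e i *: env`_i.
Proof.
elim: e => [n||a IHa b IHb|a IHa|k a IHa] /=; rewrite ?IHa ?IHb.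
- case: (ltnP n (size env)) => hn.
    rewrite (bigD1 (Ordinal hn)) //= PeanoNat.Nat.eqb_refl scale1r big1 ?addr0 //.
    move=> i ni; case: (PeanoNat.Nat.eqb_spec n i) => [e|_]; last by rewrite scale0r.
    by case/eqP: ni; apply/val_inj.
  rewrite nth_default // big1 // => i _.
  case: (PeanoNat.Nat.eqb_spec n i) => [e|_]; last by rewrite scale0r.
  by have := ltn_ord i; rewrite -e ltnNge hn.
- by rewrite big1 // => i _; rewrite scale0r.
- by rewrite -big_split; apply: eq_bigr => i _; rewrite scalerDl.
- by rewrite -sumrN; apply: eq_bigr => i _; rewrite scaleNr.
- by rewrite scaler_sumr; apply: eq_bigr => i _; rewrite scalerA.
Qed.

(** Two formal combinations agree as soon as each atom has the same coefficient
    in both; the [lmod] tactic reduces an identity between vectors to these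
    scalar equations. *)
Lemma leval_eq (env : seq V) e1 e2 :
  lcoef_eq (size env) e1 e2 -> leval env e1 = leval env e2.
Proof.
move=> h; rewrite !leval_coef; apply: eq_bigr => -[i hi] _ /=; congr (_ *: _).
elim: (size env) h hi => // n IH [h1 h2]; rewrite ltnS leq_eqVlt => /predU1P[->//|].
exact: IH.
Qed.

End LinearExpressions.

(* The position of [x] in [env], up to conversion: the same vector can occur
   with different names of its type. Fails when there is none. *)
Ltac lmod_find x env :=
  match env with
  | x :: _ => constr:(O)
  | ?y :: _ => let _ := match goal with _ => unify x y end in constr:(O)
  | _ :: ?env' => let n := lmod_find x env' in constr:(S n)
  end.
Ltac lmod_atoms t env :=
  lazymatch t with
  | (?x + ?y)%R => let env1 := lmod_atoms x env in lmod_atoms y env1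
  | (- ?x)%R => lmod_atoms x env
  | (?a *: ?x)%R => lmod_atoms x env
  | 0%R => env
  | _ => match constr:(tt) with
         | _ => let n := lmod_find t env in env
         | _ => constr:(t :: env)
         end
  end.
Ltac lmod_reify K t env :=
  lazymatch t with
  | (?x + ?y)%R => let a := lmod_reify K x env in let b := lmod_reify K y env in
                   constr:(@LAdd K a b)
  | (- ?x)%R => let a := lmod_reify K x env in constr:(@LOpp K a)
  | (?k *: ?x)%R => let a := lmod_reify K x env in constr:(@LScale K k a)
  | 0%R => constr:(@LZero K)
  | _ => let n := lmod_find t env in constr:(@LVar K n)
  end.
Ltac lmod_reduce :=
  match goal with
  | |- @eq ?T ?l ?r =>
    let V := constr:((T : lmodType _)) in
    lazymatch type of V with
    | GRing.Lmodule.type ?K0 =>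
      let K := constr:((GRing.PzRing.sort K0 : comNzRingType)) in
      let env0 := lmod_atoms l (@nil T) in
      let env := lmod_atoms r env0 in
      let el := lmod_reify K l env in
      let er := lmod_reify K r env in
      apply: (@leval_eq K _ env el er);
      cbn [lcoef_eq size lcoef Nat.eqb]; do ?split
    end
  end.
Ltac lmod := lmod_reduce; ring.
Ltac lmodf := lmod_reduce; field.


(** * Dimension of a quotient of subspaces *)

Section Dimension.
Variables (K : fieldType).

Definition is_subspace (V : lmodType K) (A : set V) : Prop :=
  A 0 /\ forall a x y, A x -> A y -> A (a *: x + y).

Definition adjoin (V : lmodType K) (A : set V) (v : V) : set V :=
  [set x | exists a, A (x - a *: v)].

(** Counting the dimension of [V / W] by flags from [W] up to [V], each step
    adding one new vector, turns every statement about dimensions into an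
    induction that changes only [W]. *)
Fixpoint hasdim (X : lmodType K) (V W : set X) (n : nat) : Prop :=
  match n with
  | 0%N => V `<=` W
  | n'.+1 => exists v, [/\ V v, ~ W v & hasdim V (adjoin W v) n']
  end.

Fixpoint dimge (X : lmodType K) (V W : set X) (n : nat) : Prop :=
  match n with
  | 0%N => True
  | n'.+1 => exists v, [/\ V v, ~ W v & dimge V (adjoin W v) n']
  end.

Section Subspaces.
Variable X : lmodType K.
Implicit Types (A B U V W : set X) (x y v : X).

Lemma subspace0 A : is_subspace A -> A 0. Proof. by case. Qed.

Lemma subspaceZ A a x : is_subspace A -> A x -> A (a *: x).
Proof. by case=> A0 h Ax; have := h a _ _ Ax A0; rewrite addr0. Qed.

Lemma subspaceD A x y : is_subspace A -> A x -> A y -> A (x + y).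
Proof. by case=> A0 h Ax Ay; have := h 1 _ _ Ax Ay; rewrite scale1r. Qed.

Lemma subspaceN A x : is_subspace A -> A x -> A (- x).
Proof. by move=> sA Ax; rewrite -scaleN1r; apply: subspaceZ. Qed.

Lemma subspaceB A x y : is_subspace A -> A x -> A y -> A (x - y).
Proof. by move=> sA Ax Ay; apply: subspaceD => //; apply: subspaceN. Qed.

Lemma subspace_sub A x y : is_subspace A -> A (x - y) -> A y -> A x.
Proof. by move=> sA Axy Ay; have := subspaceD sA Axy Ay; rewrite subrK. Qed.

Lemma subspaceI A B : is_subspace A -> is_subspace B -> is_subspace (A `&` B).
Proof.
move=> [A0 hA] [B0 hB]; split=> // a x y [Ax Bx] [Ay By].
by split; [apply: hA|apply: hB].
Qed.

Lemma subspace_set0 : is_subspace [set (0 : X)].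
Proof. by split=> // a x y -> ->; rewrite /= scaler0 addr0. Qed.

Lemma subspaceT : is_subspace [set: X].
Proof. by []. Qed.

Definition addset A B : set X := [set z | exists x y, [/\ A x, B y & z = x + y]].

Lemma subspace_addset A B : is_subspace A -> is_subspace B -> is_subspace (addset A B).
Proof.
move=> sA sB; split.
  by exists 0, 0; split; [exact: subspace0|exact: subspace0|rewrite addr0].
move=> a _ _ [x [y [Ax By ->]]] [x' [y' [Ax' By' ->]]].
exists (a *: x + x'), (a *: y + y'); split; [exact: sA.2|exact: sB.2|lmod].
Qed.

Lemma subspace_adjoin A v : is_subspace A -> is_subspace (adjoin A v).
Proof.
move=> sA; split; first by exists 0; rewrite scale0r subr0; exact: subspace0.
move=> a x y [b Ax] [c Ay]; exists (a * b + c).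
rewrite (_ : _ - _ = a *: (x - b *: v) + (y - c *: v)); last lmod.
exact: sA.2.
Qed.

Lemma sub_adjoin A v : A `<=` adjoin A v.
Proof. by move=> x Ax; exists 0; rewrite scale0r subr0. Qed.

Lemma adjoin_self A v : is_subspace A -> adjoin A v v.
Proof. by move=> sA; exists 1; rewrite scale1r subrr; exact: subspace0. Qed.

Lemma adjoin_sub A B v : is_subspace B -> A `<=` B -> B v -> adjoin A v `<=` B.
Proof.
move=> sB AB Bv x [a /AB Bx].
by apply: (subspace_sub sB Bx); apply: subspaceZ.
Qed.

Lemma adjoinC A u v : adjoin (adjoin A u) v = adjoin (adjoin A v) u.
Proof.
by rewrite predeqE => x; split=> -[a [b h]]; exists b, a;
  rewrite addrAC.
Qed.

Lemma adjoin_in A v : is_subspace A -> A v -> adjoin A v = A.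
Proof.
move=> sA Av; rewrite eqEsubset; split; last exact: sub_adjoin.
exact: adjoin_sub.
Qed.

(** Steinitz exchange for one vector; uniqueness of dimension rests on it. *)
Lemma adjoin_exchange A u v :
  is_subspace A -> adjoin A v u -> ~ A u -> adjoin A v = adjoin A u.
Proof.
move=> sA [a Auv] nAu.
have a0 : a != 0 by apply/eqP=> e; apply: nAu; move: Auv; rewrite e scale0r subr0.
rewrite predeqE => x; split=> -[b Ax].
  exists (b / a).
  rewrite (_ : _ - _ = (- (b / a)) *: (u - a *: v) + (x - b *: v)); last by lmodf.
  exact: sA.2.
exists (b * a).
rewrite (_ : _ - _ = b *: (u - a *: v) + (x - b *: u)); last lmod.
exact: sA.2.
Qed.

Lemma dimge_mono V V' W W' n :
  W' `<=` W -> V `<=` V' -> dimge V W n -> dimge V' W' n.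
Proof.
elim: n W W' => // n IH W W' W'W VV' [v [Vv nWv h]].
exists v; split; [exact: VV'|by move/W'W|apply: IH h => //].
by move=> x [a /W'W h]; exists a.
Qed.

Lemma hasdim_dimge V W n : hasdim V W n -> dimge V W n.
Proof.
by elim: n W => // n IH W [v [Vv nWv /IH h]]; exists v.
Qed.

Lemma hasdim_exchange V W u n : is_subspace W ->
  hasdim V W n.+1 -> V u -> ~ W u -> hasdim V (adjoin W u) n.
Proof.
elim: n W u => [|n IH] W u sW [v [Vv nWv h]] Vu nWu.
  by rewrite -(@adjoin_exchange _ u v) //; apply: h.
have [uWv|nuWv] := pselect (adjoin W v u).
  by rewrite -(@adjoin_exchange _ u v).
exists v; split=> //.
  move=> vWu; apply: nuWv; rewrite -(adjoin_exchange sW vWu nWv).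
  exact: adjoin_self.
by rewrite adjoinC; apply: IH => //; exact: subspace_adjoin.
Qed.

Lemma hasdim_bound V W m n : is_subspace W ->
  hasdim V W n -> dimge V W m -> (m <= n)%N.
Proof.
elim: m n W => // m IH [|n] W sW h [v [Vv nWv h']]; first by case: nWv; apply: h.
rewrite ltnS; apply: (IH _ (adjoin W v)) => //; first exact: subspace_adjoin.
exact: hasdim_exchange.
Qed.

Lemma hasdim_inj V W m n : is_subspace W -> hasdim V W m -> hasdim V W n -> m = n.
Proof.
move=> sW hm hn; apply/eqP; rewrite eqn_leq.
by rewrite (hasdim_bound sW hn (hasdim_dimge hm)) (hasdim_bound sW hm (hasdim_dimge hn)).
Qed.

Lemma dimge_or_hasdim V W m : dimge V W m \/ exists2 n, (n < m)%N & hasdim V W n.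
Proof.
elim: m W => [|m IH] W; first by left.
have [VW|] := pselect (V `<=` W); first by right; exists 0%N.
move/existsNP => [v /not_implyP[Vv nWv]].
have [h|[n nm h]] := IH (adjoin W v); first by left; exists v.
by right; exists n.+1 => //; exists v.
Qed.

Lemma hasdimP V W n : is_subspace W ->
  hasdim V W n <-> dimge V W n /\ ~ dimge V W n.+1.
Proof.
move=> sW; split=> [h|[h1 h2]].
  split; first exact: hasdim_dimge.
  by move=> /(hasdim_bound sW h); rewrite ltnn.
have [//|[k kn hk]] := dimge_or_hasdim V W n.+1.
suff -> : n = k by [].
apply/eqP; rewrite eqn_leq (hasdim_bound sW hk h1) /=.
by rewrite -ltnS.
Qed.

Lemma hasdim_from_dimge V W V' W' : is_subspace W -> is_subspace W' ->
  (forall n, dimge V W n <-> dimge V' W' n) ->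
  forall n, hasdim V W n <-> hasdim V' W' n.
Proof. by move=> sW sW' h n; rewrite !hasdimP // !h. Qed.

Definition findim V W := exists n, hasdim V W n.

Lemma findim_mono V V' W W' : is_subspace W' ->
  W' `<=` W -> V `<=` V' -> findim V' W' -> findim V W.
Proof.
move=> sW' W'W VV' [n h].
have [/(dimge_mono W'W VV')/(hasdim_bound sW' h)|[k _ hk]] := dimge_or_hasdim V W n.+1.
  by rewrite ltnn.
by exists k.
Qed.

Lemma hasdim_add V U W a b : W `<=` U -> is_subspace U ->
  hasdim V U a -> U `<=` V -> hasdim U W b -> hasdim V W (b + a).
Proof.
move=> WU sU ha UV; elim: b W WU => [|b IH] W WU hb.
  by rewrite (_ : W = U) //; rewrite eqEsubset.
case: hb => u [Uu nWu hb]; exists u; split=> //; first exact: UV.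
by apply: IH => //; apply: adjoin_sub.
Qed.

(** The vectors of the flag from [W] to [V] span a complement. Being
    finite-dimensional it is closed, which turns finite codimension into
    closedness further on. *)
Lemma hasdim_complement V W n : is_subspace V -> is_subspace W -> hasdim V W n ->
  exists M, [/\ is_subspace M, findim M [set 0], M `<=` V,
    (forall x, V x -> addset W M x) & forall x, W x -> M x -> x = 0].
Proof.
move=> sV; elim: n W => [|n IH] W sW.
  move=> VW; exists [set 0]; split=> //.
  - exact: subspace_set0.
  - by exists 0%N.
  - by move=> _ ->; exact: subspace0.
  - by move=> x /VW Wx; exists x, 0; rewrite addr0.
case=> v [Vv nWv /IH []]; first exact: subspace_adjoin.
move=> M [sM [k hk] MV VM WM]; exists (adjoin M v); split.
- exact: subspace_adjoin.
- apply: (@findim_mono _ (adjoin M v) _ [set 0]) => //; first exact: subspace_set0.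
  have [Mv|nMv] := pselect (M v); first by rewrite adjoin_in //; exists k.
  exists (k + 1)%N; apply: (@hasdim_add _ M) => //.
  + by move=> _ ->; exact: subspace0.
  + by exists v; split=> //; exact: adjoin_self.
  + exact: sub_adjoin.
- exact: adjoin_sub.
- move=> x /VM[w [m [[a Ww] Mm ->]]]; exists (w - a *: v), (a *: v + m).
  split=> //; last lmod.
  by exists a; rewrite addrAC subrr add0r.
- move=> x Wx [a Mx].
  have x0 : x - a *: v = 0.
    apply: WM => //; exists (- a); rewrite (_ : _ - _ = x) //; lmod.
  move/eqP: x0; rewrite subr_eq0 => /eqP xE.
  have [a0|a0] := eqVneq a 0; first by rewrite xE a0 scale0r.
  case: nWv; rewrite (_ : v = a^-1 *: x); first exact: subspaceZ.
  by rewrite xE scalerA mulVf // scale1r.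
Qed.

End Subspaces.

Definition linear_map (X Y : lmodType K) (f : X -> Y) :=
  forall a x y, f (a *: x + y) = a *: f x + f y.

Section LinearMaps.
Variables (X Y : lmodType K) (f : X -> Y).
Hypothesis lf : linear_map f.

Lemma linear_map0 : f 0 = 0.
Proof. by have := lf (-1) 0 0; rewrite scaleN1r addNr scaleN1r addNr. Qed.

Lemma linear_mapZ a x : f (a *: x) = a *: f x.
Proof. by have := lf a x 0; rewrite addr0 linear_map0 addr0. Qed.

Lemma linear_mapD x y : f (x + y) = f x + f y.
Proof. by have := lf 1 x y; rewrite !scale1r. Qed.

Lemma linear_mapB x y : f (x - y) = f x - f y.
Proof. by rewrite linear_mapD -scaleN1r linear_mapZ scaleN1r. Qed.

Lemma subspace_range : is_subspace (range f).
Proof.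
split; first by exists 0 => //; exact: linear_map0.
by move=> a _ _ [x _ <-] [y _ <-]; exists (a *: x + y).
Qed.

Lemma subspace_image A : is_subspace A -> is_subspace (f @` A).
Proof.
move=> sA; split; first by exists 0; [exact: subspace0|exact: linear_map0].
move=> a _ _ [x Ax <-] [y Ay <-]; exists (a *: x + y); [exact: sA.2|exact: lf].
Qed.

Lemma subspace_preimage A : is_subspace A -> is_subspace (f @^-1` A).
Proof.
move=> sA; split; first by rewrite /preimage /= linear_map0; exact: subspace0.
by move=> a x y; rewrite /preimage /= lf; exact: sA.2.
Qed.

(** The hypotheses say that [f] induces an isomorphism of [V / W] with
    [V' / W']; it carries flags to flags. *)
Lemma hasdim_iso (V W : set X) (V' W' : set Y) n :
  is_subspace V' -> is_subspace W' ->
  (forall x, V x -> V' (f x)) ->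
  (forall y, V' y -> exists2 x, V x & W' (y - f x)) ->
  (forall x, V x -> W x <-> W' (f x)) ->
  is_subspace V -> hasdim V W n <-> hasdim V' W' n.
Proof.
move=> sV'; elim: n W W' => [|n IH] W W' sW' VV' V'V WW' sV.
  split=> h x Vx; last by apply/WW' => //; apply/h/VV'.
  have [u Vu W'xu] := V'V _ Vx.
  by apply: (subspace_sub sW' W'xu); apply/WW' => //; apply: h.
have step v : V v -> hasdim V (adjoin W v) n <-> hasdim V' (adjoin W' (f v)) n.
  move=> Vv; apply: IH => //.
  - exact: subspace_adjoin.
  - by move=> y /V'V[x Vx h]; exists x => //; exact: sub_adjoin.
  - move=> x Vx; split=> -[a h]; exists a.
      rewrite -linear_mapZ -linear_mapB; apply/WW' => //.
      by apply: subspaceB => //; exact: subspaceZ.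
    apply/WW'; first by apply: subspaceB => //; exact: subspaceZ.
    by rewrite linear_mapB linear_mapZ.
split=> -[v [Vv nWv h]].
  exists (f v); split; [exact: VV'|by move/WW' => /(_ Vv)|exact/step].
have [u Vu W'vu] := V'V _ Vv.
have nW'fu : ~ W' (f u) by move=> h'; apply: nWv; apply: subspace_sub W'vu h'.
exists u; split=> //; first by move/WW' => /(_ Vu).
apply/step => //; rewrite -(@adjoin_exchange _ _ (f u) v) //.
exists 1; rewrite scale1r -opprB; exact: subspaceN.
Qed.

End LinearMaps.

(** The second isomorphism theorem. *)
Lemma hasdim_addset (X : lmodType K) (A B C : set X) n :
  is_subspace A -> is_subspace B -> (forall x, A x -> C x <-> B x) ->
  hasdim A C n <-> hasdim (addset B A) B n.
Proof.
move=> sA sB AC; apply: (@hasdim_iso _ _ id) => //.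
- exact: subspace_addset.
- by move=> x Ax; exists 0, x; rewrite add0r; split=> //; exact: subspace0.
- by move=> _ [x [y [Bx Ay ->]]]; exists y => //; rewrite addrK.
Qed.

End Dimension.

(** * Real-valued norms *)

Section Modulus.
Variable R : realType.
Implicit Types a b : R[i].

Definition modulus a : R := complex.Re `|a|.

Lemma modulusE a : `|a| = (modulus a)%:C%C.
Proof. by rewrite /modulus RRe_real // normr_real. Qed.

Lemma modulus_ge0 a : 0 <= modulus a.
Proof. by rewrite -ler0c -modulusE. Qed.

Lemma modulus_real (r : R) : modulus r%:C%C = `|r|.
Proof. by rewrite /modulus normc_def /= expr0n addr0 sqrtr_sqr. Qed.

Lemma modulusM a b : modulus (a * b) = modulus a * modulus b.
Proof.
by apply: (@complexI R); rewrite -modulusE normrM !modulusE -rmorphM.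
Qed.

Lemma modulusD a b : modulus (a + b) <= modulus a + modulus b.
Proof. by rewrite -lecR rmorphD -!modulusE ler_normD. Qed.

Lemma modulusN a : modulus (- a) = modulus a.
Proof. by rewrite /modulus normrN. Qed.

Lemma modulus_eq0 a : modulus a = 0 -> a = 0.
Proof. by move=> h; apply/eqP; rewrite -normr_eq0 modulusE h. Qed.

Lemma modulus_gt0 a : a != 0 -> 0 < modulus a.
Proof.
move=> a0; rewrite lt_neqAle modulus_ge0 andbT eq_sym.
by apply: contra a0 => /eqP/modulus_eq0 ->.
Qed.

Lemma modulusV a : a != 0 -> modulus a^-1 = (modulus a)^-1.
Proof.
move=> a0; apply: (@complexI R); rewrite -modulusE normfV modulusE.
by rewrite fmorphV.
Qed.

Lemma modulus_ge_Re a : `|complex.Re a| <= modulus a.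
Proof. by rewrite -lecR -modulusE; exact: normc_ge_Re. Qed.

Lemma modulus_ge_Im a : `|complex.Im a| <= modulus a.
Proof.
have <- : complex.Re (- (a * 'i%C)) = complex.Im a.
  by case: a => x y /=; rewrite mulr0 mulr1 sub0r opprK.
apply: le_trans (modulus_ge_Re _) _.
by rewrite modulusN modulusM {2}/modulus normc_def /= expr0n expr1n add0r sqrtr1 mulr1.
Qed.

Lemma modulus_le_ReIm a : modulus a <= `|complex.Re a| + `|complex.Im a|.
Proof.
have -> : a = (complex.Re a)%:C%C + 'i%C * (complex.Im a)%:C%C by exact: complexE.
have mi : modulus 'i%C = 1.
  by rewrite /modulus normc_def /= expr0n expr1n add0r sqrtr1.
apply: le_trans (modulusD _ _) _; rewrite modulusM mi mul1r !modulus_real.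
by case: a => x y /=; rewrite !(mul0r, mulr0, mul1r, mulr1, addr0, add0r, subr0, oppr0).
Qed.

End Modulus.

Section BanachNorm.
Variable R : realType.

Definition norm_lim (Z : lmodType R[i]) (N : Z -> R) (u : nat -> Z) (l : Z) :=
  forall e, 0 < e -> exists n0, forall n, (n0 <= n)%N -> N (u n - l) < e.

Definition norm_cauchy (Z : lmodType R[i]) (N : Z -> R) (u : nat -> Z) :=
  forall e, 0 < e -> exists n0, forall m n, (n0 <= m)%N -> (n0 <= n)%N ->
    N (u m - u n) < e.

(** A complete norm with values in [R], as a bare predicate: this lets products
    of spaces be used without equipping them with a topology. *)
Record banach_norm (Z : lmodType R[i]) (N : Z -> R) : Prop := BanachNorm {
  bnormD : forall x y, N (x + y) <= N x + N y;
  bnormZ : forall a x, N (a *: x) = modulus a * N x;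
  bnorm_eq0 : forall x, N x = 0 -> x = 0;
  bnorm_complete : forall u, norm_cauchy N u -> exists l, norm_lim N u l }.

Definition norm_closed (Z : lmodType R[i]) (N : Z -> R) (A : set Z) :=
  forall x, (forall e, 0 < e -> exists y, A y /\ N (x - y) < e) -> A x.

Definition prod_norm (Z Y : lmodType R[i]) (N : Z -> R) (M : Y -> R) : Z * Y -> R :=
  fun p => N p.1 + M p.2.

Section Basics.
Variables (Z : lmodType R[i]) (N : Z -> R).
Hypothesis bN : banach_norm N.

Lemma bnorm0 : N 0 = 0.
Proof. by rewrite -(scale0r 0) bnormZ // modulus_real normr0 mul0r. Qed.

Lemma bnormN x : N (- x) = N x.
Proof.
by rewrite -scaleN1r bnormZ // modulusN (modulus_real 1) normr1 mul1r.
Qed.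

Lemma bnorm_ge0 x : 0 <= N x.
Proof.
have := bnormD bN x (- x); rewrite subrr bnorm0 bnormN.
by lra.
Qed.

Lemma bnormB x y : N (x - y) <= N x + N y.
Proof. by rewrite -(bnormN y); exact: bnormD. Qed.

Lemma bnormC x y : N (x - y) = N (y - x).
Proof. by rewrite -bnormN opprB. Qed.

Lemma bnorm_tri z x y : N (x - y) <= N (x - z) + N (z - y).
Proof. by apply: le_trans (bnormD bN _ _); rewrite addrA subrK. Qed.

Lemma bnorm_gt0 x : x <> 0 -> 0 < N x.
Proof.
move=> x0; rewrite lt_neqAle bnorm_ge0 andbT.
by apply/eqP => /esym/(bnorm_eq0 bN).
Qed.

Lemma norm_lim_closed A u l : norm_closed N A -> (forall n, A (u n)) ->
  norm_lim N u l -> A l.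
Proof.
move=> cA Au ul; apply: cA => e /ul[n /(_ n (leqnn n)) h].
by exists (u n); rewrite bnormC.
Qed.

Lemma pow2_small c (e : R) : 0 < e -> exists n, c / 2 ^+ n < e.
Proof.
move=> e0; have [n hn] : exists n : nat, c / e < n%:R.
  have [c0|c0] := ltP (c / e) 0; first by exists 0%N.
  exists (Num.bound (c / e)).
  by have := archi_boundP c0.
exists n; rewrite ltr_pdivrMr ?exprn_gt0 // mulrC -ltr_pdivrMr //.
apply: lt_le_trans hn _; rewrite -natrX ler_nat.
by apply: ltnW; apply: ltn_expl.
Qed.

Lemma geometric_bound (u : nat -> Z) c n :
  (forall k, N (u k.+1 - u k) <= c / 2 ^+ k) -> N (u n - u 0%N) <= 2 * c - 2 * c / 2 ^+ n.
Proof.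
move=> h; elim: n => [|n IH].
  by rewrite subrr bnorm0 expr0 divr1 subrr.
apply: le_trans (bnorm_tri (u n) _ _) _.
apply: le_trans (lerD (h n) IH) _.
rewrite exprS invfM.
set t := (2 ^+ n)^-1; lra.
Qed.

Lemma geometric_lim (u : nat -> Z) c :
  (forall k, N (u k.+1 - u k) <= c / 2 ^+ k) -> exists l, norm_lim N u l.
Proof.
move=> h; apply: (bnorm_complete bN).
have c0 : 0 <= c.
  by have := h 0%N; rewrite expr0 divr1; apply: le_trans; exact: bnorm_ge0.
move=> e e0; have [n0 hn0] := pow2_small (4 * c) e0.
have H k : N (u (n0 + k)%N - u n0) <= 2 * c / 2 ^+ n0.
  have := @geometric_bound (fun j => u (n0 + j)%N) (c / 2 ^+ n0) k.
  rewrite addn0 => /(_ _)/le_trans; apply => [j|].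
    by rewrite addnS -mulrA -invfM -exprD; exact: h.
  have t0 : 0 <= 2 * (c / 2 ^+ n0) / 2 ^+ k.
    by rewrite !mulr_ge0 ?invr_ge0 ?exprn_ge0.
  have -> : 2 * c / 2 ^+ n0 = 2 * (c / 2 ^+ n0) by rewrite mulrA.
  lra.
exists n0 => m n /subnKC <- /subnKC <-.
apply: le_lt_trans (bnorm_tri (u n0) _ _) _.
rewrite (bnormC (u n0)).
apply: le_lt_trans (lerD (H _) (H _)) _.
apply: le_lt_trans hn0; rewrite -!mulrA.
by set t := c * _; lra.
Qed.

Lemma geometric_lim_bound (u : nat -> Z) c l :
  (forall k, N (u k.+1 - u k) <= c / 2 ^+ k) -> norm_lim N u l -> N (l - u 0%N) <= 2 * c.
Proof.
move=> h ul; apply/ler_addgt0Pr => e e0.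
have [n /(_ n (leqnn n)) hn] := ul e e0.
apply: le_trans (bnorm_tri (u n) _ _) _; rewrite bnormC addrC.
apply: lerD; last exact: ltW.
apply: le_trans (geometric_bound _ h) _.
have c0 : 0 <= c.
  by have := h 0%N; rewrite expr0 divr1; apply: le_trans; exact: bnorm_ge0.
have : 0 <= 2 * c / 2 ^+ n by rewrite !mulr_ge0 ?invr_ge0 ?exprn_ge0.
lra.
Qed.

Lemma norm_closedI A B : norm_closed N A -> norm_closed N B -> norm_closed N (A `&` B).
Proof.
move=> cA cB x h; split; [apply: cA|apply: cB] => e /h[y [[Ay By] xy]]; by exists y.
Qed.

Lemma norm_closedT : norm_closed N setT. Proof. by []. Qed.

Lemma norm_closed0 : norm_closed N [set 0].
Proof.
move=> x h; apply/(bnorm_eq0 bN)/eqP; rewrite eq_le bnorm_ge0 andbT.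
by apply/ler_addgt0Pr => e /h[y [->]]; rewrite subr0 add0r => /ltW.
Qed.

Lemma norm_closed_dist A v : norm_closed N A -> ~ A v ->
  exists2 r, 0 < r & forall x, A x -> r <= N (v - x).
Proof.
move=> cA; apply: contra_notP => h; apply: cA => e e0.
apply: contrapT => h'; apply: h; exists e => // x Ax.
by rewrite leNgt; apply/negP => ?; apply: h'; exists x.
Qed.

End Basics.

Lemma norm_closed_preimage (Z Y : lmodType R[i]) (N : Z -> R) (M : Y -> R)
    (f : Z -> Y) (A : set Y) c :
  0 <= c -> (forall x y, M (f x - f y) <= c * N (x - y)) ->
  norm_closed M A -> norm_closed N (f @^-1` A).
Proof.
move=> c0 hf cA x h; apply: cA => e e0.
have c1 : 0 < c + 1 by lra.
have [y [Ay xy]] := h (e / (c + 1)) (divr_gt0 e0 c1).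
exists (f y); split=> //; apply: le_lt_trans (hf _ _) _.
move: xy; rewrite ltr_pdivlMr // => xy.
have [N0|N0] := leP 0 (N (x - y)); first by lra.
by have := mulr_ge0_le0 c0 (ltW N0); lra.
Qed.

Section Product.
Variables (Z Y : lmodType R[i]) (N : Z -> R) (M : Y -> R).
Hypotheses (bN : banach_norm N) (bM : banach_norm M).

Lemma banach_prod : banach_norm (prod_norm N M).
Proof.
have l1 p : N p.1 <= prod_norm N M p by rewrite /prod_norm; have := bnorm_ge0 bM p.2; lra.
have l2 p : M p.2 <= prod_norm N M p by rewrite /prod_norm; have := bnorm_ge0 bN p.1; lra.
split.
- move=> x y; rewrite /prod_norm /=.
  have := bnormD bN x.1 y.1; have := bnormD bM x.2 y.2; lra.
- by move=> a x; rewrite /prod_norm /= (bnormZ bN) (bnormZ bM) mulrDr.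
- move=> [x y]; rewrite /prod_norm /= => h.
  have Nx := bnorm_ge0 bN x; have My := bnorm_ge0 bM y.
  by congr pair; [apply: (bnorm_eq0 bN)|apply: (bnorm_eq0 bM)]; lra.
- move=> u cu.
  have [|l1' h1] := bnorm_complete bN (u := fst \o u).
    move=> e /cu[n h]; exists n => i j ni nj.
    by apply: le_lt_trans (h i j ni nj); exact: (l1 (u i - u j)).
  have [|l2' h2] := bnorm_complete bM (u := snd \o u).
    move=> e /cu[n h]; exists n => i j ni nj.
    by apply: le_lt_trans (h i j ni nj); exact: (l2 (u i - u j)).
  exists (l1', l2') => e e0; have e2 : 0 < e / 2 by lra.
  have [n1 k1] := h1 _ e2; have [n2 k2] := h2 _ e2.
  exists (maxn n1 n2) => n; rewrite geq_max => /andP[/k1 a1 /k2 a2].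
  by rewrite /prod_norm /=; move: a1 a2 => /=; lra.
Qed.

End Product.

(** * The open mapping theorem for closed linear relations *)

Section Relations.
Variables (Z Y : lmodType R[i]) (N : Z -> R) (M : Y -> R).
Hypotheses (bN : banach_norm N) (bM : banach_norm M).
Variable G : set (Z * Y).
Hypotheses (sG : is_subspace G) (cG : norm_closed (prod_norm N M) G).

Definition rel_range : set Y := [set y | exists x, G (x, y)].

Lemma subspace_rel_range : is_subspace rel_range.
Proof.
split; first by exists 0; exact: subspace0 sG.
by move=> a y y' [x h] [x' h']; exists (a *: x + x'); exact: (sG.2 a _ _ h h').
Qed.

Lemma iter_rel_closed (x : nat -> Z) (y : nat -> Y) lx ly :
  (forall n, G (x n, y n)) -> norm_lim N x lx -> norm_lim M y ly -> G (lx, ly).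
Proof.
move=> Gxy hx hy; apply: cG => e e0; have e2 : 0 < e / 2 by lra.
have [n1 k1] := hx _ e2; have [n2 k2] := hy _ e2.
pose n := maxn n1 n2.
exists (x n, y n); split=> //; rewrite /prod_norm /= (bnormC bN) (bnormC bM).
by have := k1 n (leq_maxl _ _); have := k2 n (leq_maxr _ _); lra.
Qed.

(** Each correction halves the remainder, so the corrections have a sum, and
    solving up to half the norm at cost [c] becomes solving exactly at cost
    [2 c]. It serves three times:
    for the open mapping theorem, for the perturbation of a surjection and for
    the closedness of a perturbed range. *)
Lemma successive_approximation (D : set Y) c : 0 <= c ->
  (forall y, D y -> exists x b,
    [/\ G (x, b), N x <= c * M y, D (y - b) & M (y - b) <= M y / 2]) ->
  forall y, D y -> exists2 x, G (x, y) & N x <= 2 * c * M y.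
Proof.
move=> c0 H y Dy.
have /choice[f hf] : forall y, exists p : Z * Y, D y ->
    [/\ G (p.1, p.2), N p.1 <= c * M y, D (y - p.2) & M (y - p.2) <= M y / 2].
  move=> y'; have [Dy'|nDy'] := pselect (D y'); last by exists (0, 0).
  by have [x [b h]] := H _ Dy'; exists (x, b).
(* the current partial solution and the current remainder *)
pose s n := iter n (fun p : Z * Y => (p.1 + (f p.2).1, p.2 - (f p.2).2)) (0, y).
have sS n : s n.+1 = ((s n).1 + (f (s n).2).1, (s n).2 - (f (s n).2).2) by [].
have inv n : [/\ D (s n).2, M (s n).2 <= M y / 2 ^+ n & G ((s n).1, y - (s n).2)].
  elim: n => [|n [IH1 IH2 IH3]].
    by rewrite /s /= expr0 divr1 subrr; split=> //; exact: subspace0 sG.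
  have [h1 h2 h3 h4] := hf _ IH1.
  rewrite sS /=; split=> //.
    by apply: le_trans h4 _; rewrite exprSr invfM mulrA ler_pM2r // invr_gt0.
  rewrite (_ : y - _ = y - (s n).2 + (f (s n).2).2); last lmod.
  exact: (subspaceD sG IH3 h1).
have step n : N ((s n.+1).1 - (s n).1) <= c * M y / 2 ^+ n.
  have [IH1 IH2 _] := inv n; have [_ h2 _ _] := hf _ IH1.
  rewrite sS /= addrAC subrr add0r; apply: le_trans h2 _.
  by rewrite -mulrA; apply: ler_wpM2l.
have [l hl] := geometric_lim bN (u := fun n => (s n).1) step.
exists l; last first.
  have := geometric_lim_bound bN (u := fun n => (s n).1) step hl.
  by rewrite /s /= subr0 mulrA.
apply: (iter_rel_closed (x := fun n => (s n).1) (y := fun n => y - (s n).2)) => //.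
  by move=> n; have [_ _] := inv n.
move=> e e0; have [n0 hn0] := pow2_small (M y) e0.
exists n0 => n n0n.
rewrite (_ : _ - _ - _ = - (s n).2); last lmod.
rewrite (bnormN bM); have [_ h _] := inv n.
apply: le_lt_trans h _; apply: le_lt_trans hn0.
apply: ler_wpM2l; first exact: bnorm_ge0 bM _.
by rewrite lef_pV2 ?posrE ?exprn_gt0 // ler_weXn2l // ler1n.
Qed.

Hypothesis cD : norm_closed M rel_range.

(** Baire's argument by nested balls: if the image of every ball were nowhere
    dense in the range, the limit of a sequence of nested balls, each avoiding
    one more image, would lie in the range but in none of the images. *)
Lemma range_ball_dense : exists n : nat, exists y0 : Y, exists r : R,
  [/\ rel_range y0, 0 < r & forall y, rel_range y -> M (y - y0) < r ->
    forall e, 0 < e -> exists x b, [/\ G (x, b), N x <= n%:R & M (y - b) < e]].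
Proof.
apply: contrapT => H.
have /choice[f hf] : forall q : nat * (Y * R), exists p : Y * R,
    rel_range q.2.1 -> 0 < q.2.2 ->
    [/\ rel_range p.1, M (p.1 - q.2.1) <= q.2.2 / 2, 0 < p.2 & p.2 <= q.2.2 / 2] /\
    forall x b, G (x, b) -> N x <= q.1%:R -> 2 * p.2 <= M (p.1 - b).
  move=> [n [y0 r]] /=.
  have [Dy0|] := pselect (rel_range y0); last by exists (0, 0).
  have [r0|] := boolP (0 < r); last by exists (0, 0).
  apply: contrapT => H'; apply: H; exists n, y0, (r / 2); split=> //; first by lra.
  move=> y Dy yy0 e e0; apply: contrapT => H''; apply: H'.
  exists (y, Num.min (r / 2) (e / 2)) => _ _ /=; split.
    split=> //; first exact: ltW.
      by rewrite lt_min; apply/andP; split; lra.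
    by rewrite ge_min lexx.
  move=> x b Gxb Nx.
  have : e <= M (y - b) by rewrite leNgt; apply/negP => h; apply: H''; exists x, b.
  apply: le_trans.
  have : Num.min (r / 2) (e / 2) <= e / 2 by rewrite ge_min lexx orbT.
  lra.
pose s := fix s n : Y * R := if n is n'.+1 then f (n', s n') else (0, 1).
have inv n : rel_range (s n).1 /\ 0 < (s n).2.
  elim: n => [|n [IH1 IH2]] /=; first by split=> //; exact: subspace0 subspace_rel_range.
  by have [[h1 _ h2 _] _] := hf (n, s n) IH1 IH2.
have dist n : M ((s n.+1).1 - (s n).1) <= (s n).2 / 2.
  by have [h1 h2] := inv n; have [[_ h _ _] _] := hf (n, s n) h1 h2.
have rad n : (s n.+1).2 <= (s n).2 / 2.
  by have [h1 h2] := inv n; have [[_ _ _ h] _] := hf (n, s n) h1 h2.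
have radk n k : (s (n + k)%N).2 <= (s n).2 / 2 ^+ k.
  elim: k => [|k IH]; first by rewrite addn0 expr0 divr1.
  rewrite addnS; apply: le_trans (rad _) _.
  by rewrite exprSr invfM mulrA ler_pM2r // invr_gt0.
have shift n k : M ((s (n + k.+1)%N).1 - (s (n + k)%N).1) <= (s n).2 / 2 / 2 ^+ k.
  rewrite addnS; apply: le_trans (dist _) _.
  by rewrite mulrAC ler_pM2r ?invr_gt0.
have [l hl] := geometric_lim bM (u := fun n => (s n).1) (shift 0%N).
have [x Gxl] : rel_range l.
  by apply: (norm_lim_closed bM cD _ hl) => n; have [] := inv n.
have [n hn] : exists n : nat, N x <= n%:R.
  exists (Num.bound (N x)); apply: ltW.
  exact: archi_boundP (bnorm_ge0 bN x).
have [i1 i2] := inv n.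
have [_ /(_ x l Gxl hn)] := hf (n, s n) i1 i2.
have hl' : norm_lim M (fun k => (s (n.+1 + k)%N).1) l.
  move=> e /hl[m hm]; exists m => k mk; apply: hm.
  by apply: leq_trans mk _; exact: leq_addl.
have := geometric_lim_bound bM (shift n.+1) hl'.
rewrite addn0 (bnormC bM) => h.
have [_] := inv n.+1; rewrite /= in h *; lra.
Qed.

(** Stating the open mapping theorem for relations covers at once operators on a
    closed subspace, operators modulo a kernel, and sums of a range and a
    subspace. The scaling brings [y] into the ball where images are dense. *)
Theorem open_mapping : exists2 c, 0 <= c &
  forall y, rel_range y -> exists2 x, G (x, y) & N x <= c * M y.
Proof.
have [n [y0 [r [Dy0 r0 H]]]] := range_ball_dense.
have sD := subspace_rel_range.
have c0 : 0 <= 4 * n%:R / r by rewrite !mulr_ge0 // invr_ge0 ltW.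
exists (2 * (4 * n%:R / r)); first by lra.
apply: (@successive_approximation rel_range (4 * n%:R / r) c0).
move=> y Dy; have [->|y0'] := pselect (y = 0).
  exists 0, 0; split; first exact: subspace0 sG.
  - by rewrite (bnorm0 bN) (bnorm0 bM) mulr0.
  - by rewrite subrr; exact: subspace0 sD.
  - by rewrite subrr (bnorm0 bM) mul0r.
have My := bnorm_gt0 bM y0'.
pose t := r / (2 * M y).
have t0 : 0 < t by rewrite divr_gt0 // mulr_gt0.
have tM : t * M y = r / 2 by rewrite /t; field; lra.
have tC0 : t%:C%C != 0 :> R[i].
  by apply/eqP => /(congr1 (@complex.Re R)) /= e; move: t0; rewrite e ltxx.
have e0 : 0 < t * M y / 4 by rewrite divr_gt0 // mulr_gt0.
have [||x1 [b1 [G1 N1 M1]]] := H (y0 + t%:C%C *: y) _ _ _ e0.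
- by apply: subspaceD => //; apply: subspaceZ.
- rewrite addrAC subrr add0r (bnormZ bM) modulus_real gtr0_norm // tM; lra.
have [|x2 [b2 [G2 N2 M2]]] := H y0 Dy0 _ _ e0.
- by rewrite subrr (bnorm0 bM).
have ti : modulus (t%:C%C)^-1 = t^-1.
  by rewrite modulusV // modulus_real gtr0_norm.
exists ((t%:C%C)^-1 *: (x1 - x2)), ((t%:C%C)^-1 *: (b1 - b2)).
have Gx : G ((t%:C%C)^-1 *: (x1 - x2), (t%:C%C)^-1 *: (b1 - b2)).
  exact: (subspaceZ (t%:C%C)^-1 sG (subspaceB sG G1 G2)).
split=> //.
- rewrite (bnormZ bN) ti.
  apply: (@le_trans _ _ (t^-1 * (2 * n%:R))).
    rewrite ler_pM2l ?invr_gt0 //; apply: le_trans (bnormB bN _ _) _; lra.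
  rewrite /t invf_div le_eqVlt; apply/orP; left; apply/eqP; field; lra.
- by apply: subspaceB => //; exists ((t%:C%C)^-1 *: (x1 - x2)).
- rewrite (_ : _ - _ = (t%:C%C)^-1 *: ((y0 + t%:C%C *: y - b1) - (y0 - b2))); last by lmodf.
  rewrite (bnormZ bM) ti mulrC ler_pdivrMr // mulrAC.
  apply: le_trans (bnormB bM _ _) _; lra.
Qed.

End Relations.
End BanachNorm.

(** * Closed ranges *)

Section ClosedRanges.
Variable R : realType.

(** An open map sends a closed subspace that contains its kernel to a closed
    subspace: a preimage of a limit point can be corrected by short vectors so as
    to fall into [W]. *)
Lemma image_closed (Z Y : lmodType R[i]) (N : Z -> R) (M : Y -> R)
    (G : set (Z * Y)) (W : set Z) :
  banach_norm N -> banach_norm M ->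
  is_subspace G -> norm_closed (prod_norm N M) G -> norm_closed M (rel_range G) ->
  is_subspace W -> norm_closed N W -> (forall x, G (x, 0) -> W x) ->
  norm_closed M [set y | exists2 x, W x & G (x, y)].
Proof.
move=> bN bM sG cG cD sW cW kW y hy.
have [c c0 hc] := open_mapping bN bM sG cG cD.
have sD := subspace_rel_range sG.
have [x Gxy] : rel_range G y.
  by apply: cD => e /hy[y' [[x _ Gx] yy']]; exists y'; split=> //; exists x.
exists x => //; apply: cW => e e0.
have c1 : 0 < c + 1 by lra.
have [y' [[x' Wx' Gx'] yy']] := hy (e / (c + 1)) (divr_gt0 e0 c1).
have [b Gb Nb] : exists2 b, G (b, y - y') & N b <= c * M (y - y').
  by apply: hc; apply: subspaceB => //; [exists x|exists x'].
exists (x - b); split; last first.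
  rewrite (_ : x - (x - b) = b); last lmod.
  apply: le_lt_trans Nb _; move: yy'; rewrite ltr_pdivlMr //.
  by have := bnorm_ge0 bM (y - y'); lra.
apply: (@subspace_sub _ _ _ _ x') => //; apply: kW.
have := subspaceB sG (subspaceB sG Gxy Gb) Gx'.
rewrite (_ : _ - _ = (x - b - x', y - (y - y') - y')) //.
by rewrite (_ : y - (y - y') - y' = 0) //; lmod.
Qed.

(** The map [(x, m) |-> G x + m] on [Z * A] is open onto its closed range, and
    [rel_range G] is the image of a closed subspace of pairs that contains its
    kernel, namely of the pairs with [m] in [rel_range G]. *)
Lemma rel_range_closed (Z Y : lmodType R[i]) (N : Z -> R) (M : Y -> R)
    (G : set (Z * Y)) (A : set Y) :
  banach_norm N -> banach_norm M ->
  is_subspace G -> norm_closed (prod_norm N M) G -> is_subspace A -> norm_closed M A ->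
  norm_closed M (addset (rel_range G) A) -> norm_closed M (rel_range G `&` A) ->
  norm_closed M (rel_range G).
Proof.
move=> bN bM sG cG sA cA cGA cGI.
have bP := banach_prod bN bM.
have sD := subspace_rel_range sG.
(* (x, m) is related to y when A m and y = Gx + m *)
pose G' := [set p : (Z * Y) * Y | A p.1.2 /\ G (p.1.1, p.2 - p.1.2)].
have DG' : rel_range G' = addset (rel_range G) A.
  rewrite predeqE => y; split=> [[[x m] [/= Am Gx]]|[y' [m [[x Gx] Am ->]]]].
    by exists (y - m), m; rewrite subrK; split=> //; exists x.
  by exists (x, m); split=> //=; rewrite addrK.
have sG' : is_subspace G'.
  split.
    by split; [exact: subspace0|rewrite /= subr0; exact: subspace0 sG].
  move=> a [[x m] y] [[x' m'] y'] [/= Am Gx] [/= Am' Gx'].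
  split; first exact: sA.2.
  have := sG.2 a _ _ Gx Gx'; rewrite /= => h.
  rewrite (_ : _ - _ = a *: (y - m) + (y' - m')) //; lmod.
have cG' : norm_closed (prod_norm (prod_norm N M) M) G'.
  apply: norm_closedI.
    apply: (@norm_closed_preimage _ _ _ _ M (fun p => p.1.2) _ 1 _ _ cA) => // p q.
    rewrite /prod_norm /= mul1r; have := bnorm_ge0 bN (p.1.1 - q.1.1).
    by have := bnorm_ge0 bM (p.2 - q.2); lra.
  apply: (@norm_closed_preimage _ _ _ _ (prod_norm N M)
    (fun p : (Z * Y) * Y => (p.1.1, p.2 - p.1.2)) _ 2 _ _ cG) => // p q.
  rewrite /prod_norm /=.
  have := bnormB bM (p.2 - q.2) (p.1.2 - q.1.2).
  rewrite (_ : _ - _ = p.2 - p.1.2 - (q.2 - q.1.2)); last lmod.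
  have := bnorm_ge0 bN (p.1.1 - q.1.1); have := bnorm_ge0 bM (p.2 - q.2).
  by have := bnorm_ge0 bM (p.1.2 - q.1.2); lra.
pose W := [set q : Z * Y | (rel_range G `&` A) q.2].
have := @image_closed _ _ _ M G' W bP bM sG' cG'.
rewrite DG' => /(_ cGA).
have -> : [set y | exists2 x, W x & G' (x, y)] = rel_range G.
  rewrite predeqE => y; split=> [[[x m] [Dm Am] [/= _ Gx]]|[x Gx]].
    by apply: (subspace_sub sD _ Dm); exists x.
  exists (x, 0); first by split; [exact: subspace0 sD|exact: subspace0].
  by split; [exact: subspace0|rewrite /= subr0].
apply.
- exact: (subspace_preimage (f := snd) _ (subspaceI sD sA)).
- apply: (@norm_closed_preimage _ _ _ _ M snd _ 1 _ _ cGI) => // p q.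
  by rewrite /prod_norm /= mul1r; have := bnorm_ge0 bN (p.1 - q.1); lra.
- move=> [x m] [/= Am]; rewrite sub0r => Gx; split=> //.
  by rewrite -[m]opprK; apply: subspaceN => //; exists x.
Qed.

Lemma modulus_complete (u : nat -> R[i]) :
  (forall e, 0 < e -> exists n0, forall m n, (n0 <= m)%N -> (n0 <= n)%N ->
     modulus (u m - u n) < e) ->
  exists l, forall e, 0 < e -> exists n0, forall n, (n0 <= n)%N ->
     modulus (u n - l) < e.
Proof.
have real_complete (v : nat -> R) :
    (forall e, 0 < e -> exists n0, forall m n, (n0 <= m)%N -> (n0 <= n)%N ->
       `|v m - v n| < e) ->
    exists l, forall e, 0 < e -> exists n0, forall n, (n0 <= n)%N -> `|v n - l| < e.
  move=> cv.
  have /cauchy_cvgP cvgv : cauchy (v @ \oo).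
    apply: cauchy_exP => e e0; have [n0 h] := cv e e0.
    exists (v n0); exists n0 => // n /= n0n.
    by rewrite /ball /= ; apply: h.
  exists (lim (v @ \oo)) => e e0.
  have /cvgrPdistC_lt /(_ e e0) [n0 _ h] := cvgv.
  by exists n0 => n n0n; exact: h.
move=> cu.
have [a ha] : exists l, forall e, 0 < e -> exists n0, forall n, (n0 <= n)%N ->
    `|complex.Re (u n) - l| < e.
  apply: real_complete => e /cu[n0 h]; exists n0 => m n mn0 nn0.
  apply: le_lt_trans (h _ _ mn0 nn0).
  by have := modulus_ge_Re (u m - u n); case: (u m); case: (u n).
have [b hb] : exists l, forall e, 0 < e -> exists n0, forall n, (n0 <= n)%N ->
    `|complex.Im (u n) - l| < e.
  apply: real_complete => e /cu[n0 h]; exists n0 => m n mn0 nn0.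
  apply: le_lt_trans (h _ _ mn0 nn0).
  by have := modulus_ge_Im (u m - u n); case: (u m); case: (u n).
exists (Complex a b) => e e0; have e2 : 0 < e / 2 by lra.
have [n1 h1] := ha _ e2; have [n2 h2] := hb _ e2.
exists (maxn n1 n2) => n; rewrite geq_max => /andP[/h1 k1 /h2 k2].
apply: le_lt_trans (modulus_le_ReIm _) _.
by move: k1 k2; case: (u n) => x y /=; lra.
Qed.

Section OneSpace.
Variables (X : lmodType R[i]) (N : X -> R).
Hypothesis bN : banach_norm N.
Implicit Types (U V W : set X).

Lemma adjoin_closed W v : is_subspace W -> norm_closed N W -> norm_closed N (adjoin W v).
Proof.
move=> sW cW; have [Wv|nWv] := pselect (W v); first by rewrite adjoin_in.
have [r r0 hr] := norm_closed_dist cW nWv.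
(* the coordinate along [v] is bounded *)
have coord a w : W w -> modulus a * r <= N (a *: v + w).
  move=> Ww; have [->|a0] := eqVneq a 0.
    by rewrite (modulus_real 0) normr0 mul0r (bnorm_ge0 bN).
  rewrite (_ : _ + _ = a *: (v - (- a^-1) *: w)); last by lmodf.
  rewrite (bnormZ bN) ler_wpM2l ?modulus_ge0 //.
  by apply: hr; exact: subspaceZ.
move=> y hy.
have /choice[f hf] : forall n : nat, exists p : X * R[i],
    W (p.1 - p.2 *: v) /\ N (y - p.1) < 1 / 2 ^+ n.
  move=> n; have [|x [[a Wx] h]] := hy (1 / 2 ^+ n).
    by rewrite divr_gt0 ?exprn_gt0.
  by exists (x, a).
have small e : 0 < e -> exists n0, forall n, (n0 <= n)%N -> N (y - (f n).1) < e.
  move=> e0; have [n0 h0] := pow2_small 1 e0; exists n0 => n n0n.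
  apply: lt_trans h0; apply: lt_le_trans (hf n).2 _.
  by rewrite !div1r lef_pV2 ?posrE ?exprn_gt0 // ler_weXn2l // ler1n.
have [a ha] : exists l, forall e, 0 < e -> exists n0, forall n, (n0 <= n)%N ->
    modulus ((f n).2 - l) < e.
  apply: modulus_complete => e e0.
  have [|n0 h] := small (e * r / 2); first by rewrite divr_gt0 ?mulr_gt0.
  exists n0 => m n n0m n0n; rewrite -(ltr_pM2r r0).
  have Ww := subspaceB sW (hf m).1 (hf n).1.
  apply: le_lt_trans (coord _ _ Ww) _.
  rewrite [X in N X](_ : _ = (f m).1 - (f n).1); last lmod.
  apply: le_lt_trans (bnorm_tri bN y _ _) _; rewrite (bnormC bN).
  by have := h m n0m; have := h n n0n; lra.
exists a; apply: cW => e e0; have e2 : 0 < e / 2 by lra.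
have c0 : 0 < N v + 1 by have := bnorm_ge0 bN v; lra.
have [n1 h1] := small _ e2; have [n2 h2] := ha _ (divr_gt0 e2 c0).
pose n := maxn n1 n2.
exists ((f n).1 - (f n).2 *: v); split; first by have [] := hf n.
rewrite (_ : _ - _ = (y - (f n).1) + ((f n).2 - a) *: v); last lmod.
apply: le_lt_trans (bnormD bN _ _) _; rewrite (bnormZ bN).
have := h1 n (leq_maxl _ _); have := h2 n (leq_maxr _ _).
rewrite ltr_pdivlMr // => k.
have := modulus_ge0 ((f n).2 - a); lra.
Qed.

Lemma findim_extension_closed U W : is_subspace U -> is_subspace W -> norm_closed N W ->
  W `<=` U -> findim U W -> norm_closed N U.
Proof.
move=> sU sW cW WU [n]; elim: n W sW cW WU => [|n IH] W sW cW WU.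
  by move=> UW; rewrite (_ : U = W) // eqEsubset.
case=> v [Uv _ h]; apply: IH h.
- exact: subspace_adjoin.
- exact: adjoin_closed.
- exact: adjoin_sub.
Qed.

Lemma findim_closed U : is_subspace U -> findim U [set 0] -> norm_closed N U.
Proof.
move=> sU; apply: findim_extension_closed => //.
- exact: subspace_set0.
- exact: norm_closed0.
- by move=> _ ->; exact: subspace0.
Qed.

(** A range of finite codimension is closed: it has a finite-dimensional
    complement, so [rel_range_closed] applies. *)
Lemma rel_range_finite_codim_closed (G : set (X * X)) U :
  is_subspace G -> norm_closed (prod_norm N N) G ->
  is_subspace U -> norm_closed N U -> rel_range G `<=` U -> findim U (rel_range G) ->
  norm_closed N (rel_range G).
Proof.
move=> sG cG sU cU GU [n hn].
have sD := subspace_rel_range sG.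
have [M [sM fM MU UM DM]] := hasdim_complement sU sD hn.
apply: (rel_range_closed bN bN sG cG sM (findim_closed sM fM)).
  rewrite (_ : addset _ _ = U) // eqEsubset; split=> // _ [x [y [/GU Ux /MU Uy ->]]].
  exact: subspaceD.
rewrite (_ : _ `&` _ = [set 0]); first exact: norm_closed0.
rewrite eqEsubset; split=> [x [Dx Mx]|_ ->]; first exact: DM.
by split; exact: subspace0.
Qed.

(** * Stability of dimensions under small gaps *)

Definition gap_le (A B : set X) (e : R) :=
  forall x, A x -> exists2 y, B y & N (x - y) <= e * N x.

Lemma riesz V W v : is_subspace V -> is_subspace W -> norm_closed N W -> W `<=` V ->
  V v -> ~ W v -> exists2 u, V u /\ adjoin W u = adjoin W v &
  forall w, W w -> N u <= 2 * N (u - w).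
Proof.
move=> sV sW cW WV Vv nWv; have [r r0 hr] := norm_closed_dist cW nWv.
pose E := [set N (v - w) | w in W].
have E0 : E !=set0 by exists (N (v - 0)), 0 => //; exact: subspace0.
have hE : has_lbound E by exists r => _ [w Ww <-]; exact: hr.
have iE : r <= inf E by apply: lb_le_inf => // _ [w Ww <-]; exact: hr.
have i0 : 0 < inf E by apply: lt_le_trans iE.
have [|_ [w0 Ww0 <-] h0] := @inf_adherent _ E (inf E) i0; first by split.
exists (v - w0); first split.
- by apply: subspaceB => //; exact: WV.
- rewrite predeqE => x; split=> -[a Wx]; exists a.
    rewrite (_ : _ - _ = (x - a *: (v - w0)) - a *: w0); last lmod.
    by apply: subspaceB => //; exact: subspaceZ.
  rewrite (_ : _ - _ = (x - a *: v) + a *: w0); last lmod.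
  by apply: subspaceD => //; exact: subspaceZ.
- move=> w Ww; have : inf E <= N (v - w0 - w).
    apply: ge_inf => //; exists (w0 + w); first exact: subspaceD.
    by rewrite opprD addrA.
  lra.
Qed.

(** One estimate covers kernels ([W = W' = 0]) and cokernels ([V = V']). The
    induction adds to [W] a vector [v] far from it, and to [W'] a vector of
    [V'] close to [v]; both gaps grow by a bounded factor. *)
Lemma gap_dimge m : exists2 eta, 0 < eta &
  forall V W V' W', is_subspace V -> is_subspace W -> norm_closed N W -> W `<=` V ->
    is_subspace W' -> gap_le V V' eta -> gap_le W' W eta ->
    dimge V W m -> dimge V' W' m.
Proof.
elim: m => [|m [eta eta0 IH]]; first by exists 1.
exists (Num.min (1/16) (eta / 16)); first by rewrite lt_min; apply/andP; split; lra.
set e := Num.min _ _ => V W V' W' sV sW cW WV sW' gV gW [v0 [Vv0 nWv0 h]].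
have e1 : e <= 1/16 by rewrite ge_min lexx.
have e2 : e <= eta / 16 by rewrite ge_min lexx orbT.
have e0 : 0 < e by rewrite lt_min; apply/andP; split; lra.
have N0 := bnorm_ge0 bN.
have [v [Vv vE] hv] := riesz sV sW cW WV Vv0 nWv0.
have nWv : ~ W v.
  move=> Wv; apply: nWv0; suff : adjoin W v v0 by rewrite adjoin_in.
  by rewrite vE; exact: adjoin_self.
have Nv : 0 < N v by apply: (bnorm_gt0 bN) => v0'; apply: nWv; rewrite v0'; exact: subspace0.
have [v' V'v' vv'] := gV _ Vv.
have Nv' : N v' <= N v + e * N v.
  have := bnormD bN v (v' - v); rewrite addrC subrK (bnormC bN v'); lra.
have eNv : e * N v <= N v / 16 by have := ler_wpM2r (ltW Nv) e1; lra.
exists v'; split=> //.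
  move=> /gW[w Ww v'w]; have := hv _ Ww.
  have := bnorm_tri bN v' v w.
  have := ler_wpM2l (ltW e0) Nv'; have := ler_wpM2r (N0 v) (ltW e0).
  have := ler_wpM2l (ltW e0) eNv; lra.
apply: (IH V (adjoin W v)) => //.
- exact: subspace_adjoin.
- exact: adjoin_closed.
- exact: adjoin_sub.
- exact: subspace_adjoin.
- move=> x /gV[y V'y xy]; exists y => //; apply: le_trans xy _.
  by apply: ler_wpM2r => //; lra.
- move=> t [a W't]; have [w Ww ww'] := gW _ W't.
  exists (w + a *: v); first by exists a; rewrite addrK.
  pose A := modulus a * N v; pose B := N (t - a *: v').
  have A0 : 0 <= A by rewrite mulr_ge0 // modulus_ge0.
  have eA : modulus a * N (v - v') <= e * A.
    rewrite /A mulrCA; apply: ler_wpM2l => //; exact: modulus_ge0.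
  have aw : A <= 2 * N (w + a *: v).
    have [a0|a0] := eqVneq a 0.
      by rewrite /A a0 (modulus_real 0) normr0 mul0r; have := N0 (w + 0 *: v); lra.
    have := hv (- a^-1 *: w) (subspaceZ _ sW Ww).
    rewrite -(ler_pM2l (modulus_gt0 a0)) -/A => /le_trans; apply.
    rewrite (_ : w + a *: v = a *: (v - - a^-1 *: w)); last by lmodf.
    by rewrite (bnormZ bN) mulrCA.
  have tt : N (t - (w + a *: v)) <= e * B + e * A.
    rewrite (_ : _ - _ = (t - a *: v' - w) + a *: (v' - v)); last lmod.
    apply: le_trans (bnormD bN _ _) _; rewrite (bnormZ bN) (bnormC bN v').
    exact: lerD.
  have t1 : N (w + a *: v) <= N t + e * B + e * A.
    have := bnormB bN t (t - (w + a *: v)); rewrite opprB addrC subrK; lra.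
  have B1 : B <= N t + (A + e * A).
    apply: le_trans (bnormB bN _ _) _; rewrite lerD2l (bnormZ bN).
    have := ler_wpM2l (modulus_ge0 a) Nv'; rewrite /A; lra.
  have eA' := ler_wpM2r A0 e1.
  have eB' := ler_wpM2r (N0 (t - a *: v')) e1; rewrite -/B in eB'.
  have A5 : A <= 5 * N t by lra.
  have B11 : B <= 11 * N t by lra.
  apply: le_trans tt _.
  have := ler_wpM2l (ltW e0) A5; have := ler_wpM2l (ltW e0) B11.
  have := ler_wpM2r (N0 t) e2; lra.
- by rewrite vE.
Qed.

End OneSpace.
End ClosedRanges.

(** * Flags, bases and infima *)

Section NatInf.
Variable R : realType.
Implicit Types P : set nat.

Lemma nat_inf_set0 P : ~ (P !=set0) -> nat_inf R P = +oo%E.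
Proof.
by move=> h; rewrite /nat_inf (_ : P = set0) ?image_set0 ?ereal_inf0 //;
  apply/seteqP; split=> // n Pn; case: h; exists n.
Qed.

Lemma nat_inf_min P n : P n -> (forall m, P m -> (n <= m)%N) ->
  nat_inf R P = n%:R%:E.
Proof.
move=> Pn h; apply/eqP; rewrite eq_le; apply/andP; split.
  by apply: ereal_inf_lbound; exists n.
by apply: le_ereal_inf_tmp => _ [m /h nm <-]; rewrite lee_fin ler_nat.
Qed.

Lemma nat_inf_attained P : P !=set0 ->
  exists n, [/\ P n, (forall m, P m -> (n <= m)%N) & nat_inf R P = n%:R%:E].
Proof.
case=> n0 /asboolP Pn0.
have [n /asboolP Pn h] := ex_minnP (ex_intro (fun n => `[< P n >]) n0 Pn0).
have h' m : P m -> (n <= m)%N by move=> Pm; apply: h; apply/asboolP.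
by exists n; split=> //; exact: nat_inf_min.
Qed.

Lemma nat_inf_fin P : (nat_inf R P < +oo)%E <-> P !=set0.
Proof.
split=> [h|/nat_inf_attained[n [_ _ ->]]]; last exact: ltry.
by apply: contrapT => /nat_inf_set0 h'; move: h; rewrite h' ltxx.
Qed.

Lemma nat_inf_oo P : nat_inf R P = +oo%E <-> ~ (P !=set0).
Proof.
split=> [h /nat_inf_attained[n [_ _]]|]; first by rewrite h.
exact: nat_inf_set0.
Qed.

Lemma nat_inf_eq P n : nat_inf R P = n%:R%:E -> P n.
Proof.
have [/nat_inf_attained[m [Pm _ ->]]|/nat_inf_set0 -> //] := pselect (P !=set0).
by move=> [/eqP]; rewrite eqr_nat => /eqP <-.
Qed.

End NatInf.

Section Bridge.
Variables (R : realType) (X : completeNormedModType R[i]).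
Implicit Types (U V W : set X).

Definition nm (x : X) : R := complex.Re `|x|.

Lemma nmE x : `|x| = (nm x)%:C%C.
Proof. by rewrite /nm RRe_real // normr_real. Qed.

Lemma banach_nm : banach_norm nm.
Proof.
split.
- by move=> x y; rewrite -lecR rmorphD /= -!nmE ler_normD.
- by move=> a x; apply: (@complexI R); rewrite -nmE normrZ nmE modulusE rmorphM.
- by move=> x h; apply/eqP; rewrite -normr_eq0 nmE h.
- move=> u cu.
  have real_lt (r : R) (e : R[i]) : 0 < e -> r < complex.Re e -> r%:C%C < e.
    by move=> e0 h; move: e0; rewrite !ltcE /= => /andP[/eqP -> _]; rewrite eqxx.
  have re_gt0 (e : R[i]) : 0 < e -> 0 < complex.Re e.
    by rewrite ltcE => /andP[].
  have /cauchy_cvgP cvu : cauchy (u @ \oo).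
    apply: cauchy_exP => e e0; have [n0 h] := cu _ (re_gt0 e e0).
    exists (u n0); exists n0 => // n /= n0n.
    by rewrite -ball_normE /= nmE; apply: real_lt => //; exact: h.
  exists (lim (u @ \oo)) => e e0.
  have e0C : 0 < e%:C%C :> R[i] by rewrite ltcR.
  have /cvgrPdistC_lt /(_ _ e0C) [n0 _ h] := cvu.
  by exists n0 => n n0n; rewrite -ltcR -nmE; exact: h.
Qed.

Lemma nm_closed (A : set X) : closed A <-> norm_closed nm A.
Proof.
split=> cA x h.
  apply: cA => B /nbhs_ballP[e /= e0 eB].
  have [|y [Ay xy]] := h (complex.Re e); first by move: e0; rewrite ltcE => /andP[].
  exists y; split=> //; apply: eB; rewrite -ball_normE /= nmE.
  by move: e0; rewrite !ltcE /= => /andP[/eqP -> _]; rewrite eqxx.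
apply: cA => e e0.
have e0C : 0 < e%:C%C :> R[i] by rewrite ltcR.
have [y [Ay]] := h _ (nbhsx_ballx x _ e0C).
by rewrite -ball_normE /= nmE ltcR => ?; exists y.
Qed.

Lemma nm_dense (A : set X) : dense A ->
  forall x e, 0 < e -> exists y, A y /\ nm (x - y) < e.
Proof.
move=> dA x e e0.
have e0C : 0 < e%:C%C :> R[i] by rewrite ltcR.
have [y [xy Ay]] : (ball x e%:C%C `&` A) !=set0.
  apply: dA; last exact: ball_open.
  by exists x; exact: ballxx.
by exists y; split=> //; rewrite -ltcR -nmE; move: xy; rewrite -ball_normE.
Qed.

Lemma quotient_basis_hasdim V W n : is_subspace V -> is_subspace W ->
  (exists v : 'I_n -> X, quotient_basis V W v) <-> hasdim V W n.
Proof.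
move=> sV; elim: n W => [|n IH] W sW.
  split=> [[v [_ h]] x /h[c []]|VW].
    by rewrite big_ord0 subr0.
  exists (fun=> 0); split=> [[]//|x /VW Wx]; exists 0; split.
    by rewrite big_ord0 subr0.
  by move=> c _; apply/rowP => -[].
split=> [[v [Vv hv]]|[v0 [Vv0 nWv0]]].
  exists (v ord0); split=> //.
    move=> Wv0; have [c [_ hc]] := hv _ (subspace0 sV).
    have c0 : c = 0.
      apply: hc; rewrite big1 ?subr0; first exact: subspace0.
      by move=> i _; rewrite mxE scale0r.
    have : c = delta_mx 0 ord0.
      apply: hc; rewrite (bigD1 ord0) //= big1 ?addr0; last first.
        by move=> i i0; rewrite mxE (negbTE i0) andbF scale0r.
      by rewrite mxE !eqxx scale1r sub0r; exact: subspaceN.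
    rewrite c0 => /matrixP/(_ 0 ord0)/eqP.
    by rewrite !mxE !eqxx eq_sym oner_eq0.
  apply/IH; first exact: subspace_adjoin.
  exists (v \o lift ord0); split=> [i|x /hv[c [Wc hc]]]; first exact: Vv.
  exists (\row_j c 0 (lift ord0 j)); split.
    exists (c 0 ord0); move: Wc; rewrite big_ord_recl opprD addrA addrAC.
    by under [in X in _ -> X]eq_bigr do rewrite mxE.
  move=> c' [a Wc'].
  have e : c = \row_j (if unlift ord0 j is Some k then c' 0 k else a).
    apply: hc; rewrite big_ord_recl mxE unlift_none opprD addrA addrAC.
    by under eq_bigr do rewrite mxE liftK.
  by apply/rowP => j; rewrite e !mxE liftK.
move=> /(IH _ (subspace_adjoin v0 sW))[v [Vv hv]].
exists (fun j => if unlift ord0 j is Some k then v k else v0); split.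
  by move=> j; case: unliftP => [k|] _.
have split_sum x (c : 'rV_n.+1) :
    x - \sum_j c 0 j *: (if unlift ord0 j is Some k then v k else v0) =
    x - \sum_k (\row_k c 0 (lift ord0 k)) 0 k *: v k - c 0 ord0 *: v0.
  rewrite big_ord_recl unlift_none opprD addrA addrAC.
  by congr (_ - _ - _); apply: eq_bigr => k _; rewrite liftK mxE.
move=> x /hv[c [[a Wc] hc]].
exists (\row_j (if unlift ord0 j is Some k then c 0 k else a)); split.
  rewrite split_sum mxE unlift_none.
  by under eq_bigr do rewrite !mxE liftK.
move=> c'; rewrite split_sum => Wc'.
have e : c = \row_k c' 0 (lift ord0 k).
  by apply: hc; exists (c' 0 ord0).
apply/rowP => j; rewrite mxE; case: unliftP => [k|] ->; first by rewrite e mxE.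
apply/eqP; rewrite eq_sym -subr_eq0; apply/eqP.
apply: contrapT => /eqP ca; apply: nWv0.
have := subspaceB sW Wc Wc'; rewrite -e.
have cancel (s : X) b b' : x - s - b *: v0 - (x - s - b' *: v0) = (b' - b) *: v0.
  lmod.
rewrite cancel.
move=> /(subspaceZ (c' 0 ord0 - a)^-1 sW).
by rewrite scalerA mulVf // scale1r.
Qed.

Lemma quotient_dimE V W : is_subspace V -> is_subspace W ->
  quotient_dim V W = nat_inf R [set n | hasdim V W n].
Proof.
move=> sV sW; congr nat_inf; apply/seteqP.
by split=> n /quotient_basis_hasdim; apply.
Qed.

Lemma quotient_dim_hasdim V W n : is_subspace V -> is_subspace W ->
  quotient_dim V W = n%:R%:E <-> hasdim V W n.
Proof.
move=> sV sW; rewrite quotient_dimE //; split=> [|h].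
  have [/(nat_inf_attained R)[m [hm _ ->]]|/(@nat_inf_set0 R) ->//] :=
    pselect ([set n | hasdim V W n] !=set0).
  by move=> [/eqP]; rewrite eqr_nat => /eqP <-.
by apply: nat_inf_min => // m /(hasdim_inj sW h) ->.
Qed.

Lemma quotient_dim_findim V W : is_subspace V -> is_subspace W ->
  (quotient_dim V W < +oo)%E <-> findim V W.
Proof. by move=> sV sW; rewrite quotient_dimE // nat_inf_fin. Qed.

Lemma quotient_dim_infinite V W : is_subspace V -> is_subspace W ->
  ~ findim V W -> quotient_dim V W = +oo%E.
Proof. by move=> sV sW h; rewrite quotient_dimE //; exact: nat_inf_set0. Qed.

Lemma quotient_dim_eq V W V' W' : is_subspace V -> is_subspace W ->
  is_subspace V' -> is_subspace W' ->
  (forall n, hasdim V W n <-> hasdim V' W' n) -> quotient_dim V W = quotient_dim V' W'.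
Proof.
move=> sV sW sV' sW' h; rewrite !quotient_dimE //; congr nat_inf.
by apply/seteqP; split=> n /h.
Qed.

End Bridge.

(** * Kernels and ranges of the powers of an operator *)

Section Powers.
Variables (R : realType) (X : completeNormedModType R[i]) (S : X -> X).
Hypothesis lS : linear_map S.
Implicit Types (m n d j : nat).

Lemma linear_iter n : linear_map (iter n S).
Proof. by elim: n => // n IH a x y; rewrite !iterS IH lS. Qed.

Lemma subspace_null n : is_subspace (null_space (iter n S)).
Proof. exact: (subspace_preimage (linear_iter n) (@subspace_set0 _ X)). Qed.

Lemma subspace_null1 : is_subspace (null_space S).
Proof. exact: (subspace_null 1). Qed.

Lemma subspace_power n : is_subspace (range (iter n S)).
Proof. exact: subspace_range (linear_iter n). Qed.

Lemma subspace_null_power n : is_subspace (null_space S `&` range (iter n S)).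
Proof. exact: subspaceI subspace_null1 (subspace_power n). Qed.

Lemma range_powerS n : S @` range (iter n S) = range (iter n.+1 S).
Proof. by rewrite image_comp. Qed.

Lemma range_power_mono m n : (m <= n)%N -> range (iter n S) `<=` range (iter m S).
Proof.
by move=> mn _ [x _ <-]; exists (iter (n - m) S x); rewrite // -iterD subnKC.
Qed.

Lemma null_mono m n : (m <= n)%N -> null_space (iter m S) `<=` null_space (iter n S).
Proof.
move=> mn x; rewrite /null_space /= => x0.
by rewrite -(subnK mn) iterD x0 (linear_map0 (linear_iter _)).
Qed.

(** The isomorphism is [S^n]. *)
Lemma hasdim_null_power n k :
  hasdim (null_space (iter n.+1 S)) (null_space (iter n S)) k <->
  hasdim (null_space S `&` range (iter n S)) [set 0] k.
Proof.
apply: (@hasdim_iso _ _ _ _ (linear_iter n)) => //.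
- exact: subspace_null_power.
- exact: subspace_set0.
- move=> y [Sy [x _ xy]]; exists x; first by rewrite /null_space /= xy.
  by rewrite xy /= subrr.
- exact: subspace_null.
Qed.

Lemma hasdim_range_step n k :
  null_space S `&` range (iter n S) `<=` range (iter n.+1 S) ->
  hasdim (range (iter n S)) (range (iter n.+1 S)) k <->
  hasdim (range (iter n.+1 S)) (range (iter n.+2 S)) k.
Proof.
move=> h; apply: (@hasdim_iso _ _ _ _ lS) => //.
- exact: subspace_power.
- exact: subspace_power.
- by move=> _ [x _ <-]; exists x.
- move=> _ [x _ <-]; exists (iter n S x); first by exists x.
  by rewrite subrr; exact: subspace0 (subspace_power _).
- move=> x Rx; split=> [[u _ <-]|[u _ ux]]; first by exists u.
  apply: (@subspace_sub _ _ _ _ (iter n.+1 S u)); first exact: subspace_power.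
    apply: h; split; first by rewrite /null_space /= (linear_mapB lS) -ux subrr.
    apply: subspaceB => //; first exact: subspace_power.
    by exists (S u) => //; rewrite -iterSr.
  by exists u.
- exact: subspace_power.
Qed.

(** The algebraic half of uniform descent; see [stable_nullP]. *)
Definition stable_null d :=
  forall n, null_space S `&` range (iter d S) `<=` range (iter n S).

Lemma stable_null_power d n : stable_null d -> (d <= n)%N ->
  null_space S `&` range (iter n S) = null_space S `&` range (iter d S).
Proof.
move=> h dn; apply/seteqP; split=> x [Sx Rx]; split=> //.
  exact: range_power_mono Rx.
exact: h.
Qed.

Lemma stable_null_range d n k : stable_null d -> (d <= n)%N ->
  hasdim (range (iter n S)) (range (iter n.+1 S)) k <->
  hasdim (range (iter d S)) (range (iter d.+1 S)) k.
Proof.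
move=> h /subnKC <-; elim: (n - d)%N => [|j IH]; first by rewrite addn0.
rewrite addnS -hasdim_range_step // => x.
by rewrite (stable_null_power h (leq_addr _ _)) => /h.
Qed.

Lemma stable_null_steps d :
  (forall n, (d <= n)%N ->
    null_space S `&` range (iter n S) `<=` range (iter n.+1 S)) -> stable_null d.
Proof.
move=> h n; have [nd|/subnKC <-] := leqP n d.
  by move=> x [_]; exact: range_power_mono.
elim: (n - d.+1)%N => [|j IH] x [Sx Rx].
  by rewrite addn0; exact: h.
rewrite addnS; apply: h; first by rewrite addSn ltnW // ltnS leq_addr.
by split=> //; apply: IH.
Qed.

Lemma stable_nullP d : (forall n, (d <= n)%N -> k_ S n = 0%E) <-> stable_null d.
Proof.
have k0 n : k_ S n = 0%E <->
    range (iter n S) `&` null_space S `<=` range (iter n.+1 S) `&` null_space S.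
  apply: (quotient_dim_hasdim 0).
    exact: subspaceI (subspace_power n) subspace_null1.
  exact: subspaceI (subspace_power n.+1) subspace_null1.
split=> [h|h n dn].
  by apply: stable_null_steps => n /h/k0 hn x [Sx Rx]; have [] := hn x.
apply/k0 => x [Rx Sx]; split=> //; apply: h; split=> //.
exact: range_power_mono Rx.
Qed.

End Powers.

Section BoundedPowers.
Variables (R : realType) (X : completeNormedModType R[i]) (S : X -> X).
Implicit Types (m n d j : nat).
Local Notation nm := (@nm R X).
Local Notation bnm := (@banach_nm R X).

Definition bounded_linear := linear_map S /\
  exists2 c, 0 <= c & forall x, nm (S x) <= c * nm x.

Hypothesis bS : bounded_linear.
Let lS : linear_map S := bS.1.

Lemma iter_lipschitz n :
  exists2 c, 0 <= c & forall x y, nm (iter n S x - iter n S y) <= c * nm (x - y).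
Proof.
have [c c0 hc] := bS.2.
exists (c ^+ n); first exact: exprn_ge0.
elim: n => [|n IH] x y; first by rewrite expr0 mul1r.
rewrite !iterS -(linear_mapB lS); apply: le_trans (hc _) _.
by rewrite exprS -mulrA; apply: ler_wpM2l.
Qed.

Lemma power_preimage_closed d (A : set X) :
  norm_closed nm A -> norm_closed nm (iter d S @^-1` A).
Proof.
have [c c0 hc] := iter_lipschitz d.
exact: norm_closed_preimage c0 hc.
Qed.

Lemma null_closed n : norm_closed nm (null_space (iter n S)).
Proof. exact: power_preimage_closed (norm_closed0 bnm). Qed.

(** The closed relation whose range is [S^-d (R(S^(d+j)))], that is
    [N(S^d) + R(S^j)]. *)
Definition power_rel d j : set (X * X) :=
  [set p | iter d S p.2 = iter (d + j) S p.1].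

Definition power_preimage d j : set X := iter d S @^-1` range (iter (d + j) S).

Lemma rel_range_power d j : rel_range (power_rel d j) = power_preimage d j.
Proof. by apply/seteqP; split=> y [x]; [|move=> _]; exists x. Qed.

Lemma range_power_rel n : range (iter n S) = rel_range (power_rel 0 n).
Proof. by rewrite rel_range_power. Qed.

Lemma subspace_power_rel d j : is_subspace (power_rel d j).
Proof.
split; first by rewrite /power_rel /= !(linear_map0 (linear_iter lS _)).
move=> a [x y] [x' y']; rewrite /power_rel /= => h h'.
by rewrite !(linear_iter lS) h h'.
Qed.

Lemma power_rel_closed d j : norm_closed (prod_norm nm nm) (power_rel d j).
Proof.
have [c c0 hc] := iter_lipschitz d; have [c' c0' hc'] := iter_lipschitz (d + j).
rewrite (_ : power_rel d j =
  (fun p : X * X => iter d S p.2 - iter (d + j) S p.1) @^-1` [set 0]); last first.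
  apply/seteqP; split=> p; rewrite /power_rel /preimage /=.
    by move=> ->; rewrite subrr.
  by move/eqP; rewrite subr_eq0 => /eqP.
apply: (@norm_closed_preimage _ _ _ _ nm _ _ (c + c') _ _ (norm_closed0 bnm)).
  exact: addr_ge0.
move=> p q; rewrite /prod_norm /=.
rewrite [X in nm X <= _](_ : _ = (iter d S p.2 - iter d S q.2)
  - (iter (d + j) S p.1 - iter (d + j) S q.1)); last lmod.
apply: le_trans (bnormB bnm _ _) _.
apply: le_trans (lerD (hc _ _) (hc' _ _)) _.
have := mulr_ge0 c0 (bnorm_ge0 bnm (p.1 - q.1)).
have := mulr_ge0 c0' (bnorm_ge0 bnm (p.2 - q.2)).
by rewrite !mulrDl !mulrDr; lra.
Qed.

Lemma subspace_power_preimage d j : is_subspace (power_preimage d j).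
Proof. exact: (subspace_preimage (linear_iter lS d) (subspace_power lS _)). Qed.

Definition uniform_descent d :=
  stable_null S d /\ forall j, norm_closed nm (power_preimage d j).

(** [S^d] induces an isometry of [X / N(S^d)] onto [R(S^d)] with its range
    norm, so closedness in that norm is closedness of a preimage in [X]. *)
Lemma range_norm_closedP d (A : set X) : is_subspace A ->
  A `<=` range (iter d S) ->
  range_norm_closed S d A <-> norm_closed nm (iter d S @^-1` A).
Proof.
move=> sA AR; have ld := linear_iter lS d.
split=> [h x hx|h y [x _ <-] hx].
  apply: h; first by exists x.
  move=> e /hx[x' [Ax' xx']]; exists (iter d S x'); split=> //.
  apply: le_lt_trans xx'; apply: ge_inf.
    by exists 0 => _ [u _ <-]; exact: (bnorm_ge0 bnm).
  by exists (x - x') => //=; rewrite (linear_mapB ld).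
apply: h => e /hx[z [Az [x' _ x'z] lt_e]].
have [|_ [u /= hu <-] ue] := inf_lt _ lt_e.
  by exists (nm (x - x')), (x - x') => //=; rewrite (linear_mapB ld) x'z.
exists (x - u); split; last by rewrite (_ : _ - _ = u) //; lmod.
by rewrite /preimage /= (linear_mapB ld) -hu (_ : _ - _ = z) //; lmod.
Qed.

Lemma uniform_descentP :
  topological_uniform_descent S <-> exists d, uniform_descent d.
Proof.
have clP d n : (d <= n)%N -> range_norm_closed S d (range (iter n S)) <->
    norm_closed nm (power_preimage d (n - d)).
  move=> dn; rewrite /power_preimage subnKC //; apply: range_norm_closedP.
    exact: subspace_power.
  exact: range_power_mono.
split=> -[d [hk h]]; exists d; split.
- exact/stable_nullP.
- by move=> j; have := h _ (leq_addr j d); move=> /clP; rewrite leq_addr addKn; apply.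
- exact/(stable_nullP lS).
- by move=> n dn; apply/clP.
Qed.

End BoundedPowers.

(** * Local constancy near a point of uniform descent *)

Section SmallSteps.
Variable R : realType.

(** Two points of the disc are joined by a chain of short steps along the
    segment between them. *)
Lemma small_steps (P : R[i] -> Prop) (r delta : R) : 0 < delta ->
  (forall a b, modulus a <= r -> modulus b <= r -> modulus (a - b) <= delta ->
    P a -> P b) ->
  forall a b, modulus a <= r -> modulus b <= r -> P a -> P b.
Proof.
move=> d0 H a b ar br Pa.
pose D := modulus (b - a).
have D0 : 0 <= D := modulus_ge0 _.
have [n hn] : exists n : nat, D / delta < n.+1%:R.
  exists (Num.bound (D / delta)).
  apply: lt_trans (archi_boundP _) _; first by rewrite divr_ge0 // ltW.
  by rewrite ltr_nat.
pose s (k : nat) : R := k%:R / n.+1%:R.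
pose z k : R[i] := a + (s k)%:C%C * (b - a).
have n0 : 0 < n.+1%:R :> R by rewrite ltr0n.
have zr k : (k <= n.+1)%N -> modulus (z k) <= r.
  move=> kn; have s0 : 0 <= s k by rewrite divr_ge0 // ltW.
  have s1 : s k <= 1 by rewrite ler_pdivrMr // mul1r ler_nat.
  have -> : z k = (1 - s k)%:C%C * a + (s k)%:C%C * b.
    by rewrite /z rmorphB rmorph1; ring.
  apply: le_trans (modulusD _ _) _; rewrite !modulusM !modulus_real.
  rewrite !ger0_norm ?subr_ge0 //.
  have := ler_wpM2l s0 br; have : 0 <= 1 - s k by lra.
  by move=> /ler_wpM2l /(_ _ _ ar); lra.
have -> : b = z n.+1.
  by rewrite /z /s divff ?gt_eqF // mul1r addrC subrK.
suff H' k : (k <= n.+1)%N -> P (z k) by exact: H'.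
elim: k => [|k IH] kn; first by rewrite /z /s mul0r mul0r addr0.
apply: (H (z k)); [exact/zr/ltnW|exact: zr| |exact/IH/ltnW].
have -> : z k - z k.+1 = (- (n.+1%:R^-1))%:C%C * (b - a).
  rewrite /z /s -[k.+1%:R]natr1 mulrDl mul1r rmorphD rmorphN /=; ring.
rewrite modulusM modulus_real normrN ger0_norm ?invr_ge0 1?mulrC; last exact: ltW.
by rewrite -/D ler_pdivrMr // mulrC -ler_pdivrMr // ltW.
Qed.

End SmallSteps.

Section LocalConstancy.
Variables (R : realType) (X : completeNormedModType R[i]) (S : X -> X).
Local Notation nm := (@nm R X).
Local Notation bnm := (@banach_nm R X).
Hypothesis bS : bounded_linear S.
Let lS : linear_map S := bS.1.
Variable d : nat.
Hypothesis ud : uniform_descent S d.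

(* [ker a] and [ran a] are the kernel and the range of [A - a], pulled back to
   [X], where [A] is the operator induced by [S] on [X / K]. *)
Let K : set X := null_space (iter d S).
Let Rinf : set X := [set x | forall j, power_preimage S d j x].
Let ker (a : R[i]) : set X := [set x | K (shift S a x)].
Let ran (a : R[i]) : set X := [set y | exists x, K (y - shift S a x)].

Let sK : is_subspace K := subspace_null lS d.
Let cK : norm_closed nm K := null_closed bS (n := d).
Let nm_ge0 := bnorm_ge0 bnm.

Lemma linear_shift (T : X -> X) a : linear_map T -> linear_map (shift T a).
Proof. by move=> lT b x y; rewrite /shift lT; lmod. Qed.

Lemma shift0 x : shift S 0 x = S x.
Proof. by rewrite /shift scale0r subr0. Qed.

Lemma iter_shift n a x : iter n S (shift S a x) = shift S a (iter n S x).
Proof.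
rewrite /shift (linear_mapB (linear_iter lS n)) (linear_mapZ (linear_iter lS n)).
by rewrite -iterSr.
Qed.

Let sRinf : is_subspace Rinf.
Proof.
split=> [j|a x y hx hy j]; first exact: subspace0 (subspace_power_preimage bS d j).
exact: (subspace_power_preimage bS d j).2.
Qed.

Let cRinf : norm_closed nm Rinf.
Proof.
move=> x h j; apply: ud.2 => e /h[y [hy xy]]; exists y; split=> //; exact: hy.
Qed.

Let sker a : is_subspace (ker a).
Proof. exact (subspace_preimage (linear_shift a lS) sK). Qed.

Let sran a : is_subspace (ran a).
Proof.
split; first by exists 0; rewrite (linear_map0 (linear_shift a lS)) subrr; exact: subspace0 sK.
move=> b y y' [x hx] [x' hx']; exists (b *: x + x').
rewrite (linear_shift a lS).
rewrite [X in K X](_ : _ = b *: (y - shift S a x) + (y' - shift S a x')); last lmod.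
exact: sK.2.
Qed.

Let K_ker a : K `<=` ker a.
Proof.
move=> x Kx; rewrite /ker /K /null_space /= iter_shift Kx.
exact: linear_map0 (linear_shift a lS).
Qed.

(** For [a <> 0] a vector killed by [S - a] modulo [K] is [S] of a multiple of
    itself modulo [K], hence in every range; for [a = 0] this is where
    [stable_null] enters. *)
Let ker_Rinf a : ker a `<=` Rinf.
Proof.
move=> x; rewrite /ker /K /null_space /= iter_shift => /eqP.
rewrite /shift subr_eq0 => /eqP Sx; have [a0|a0] := eqVneq a 0.
  move=> j; apply: ud.1; split; last by exists x.
  by rewrite /null_space /= Sx a0 scale0r.
elim=> [|j [u _ ux]]; first by rewrite /power_preimage addn0; exists x.
exists (a^-1 *: u) => //; rewrite addnS.
rewrite (linear_mapZ (linear_iter lS _)) iterS ux Sx scalerA mulVf //.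
by rewrite scale1r.
Qed.

(** If [S^d y = S^(d+j+1) u = S^(d+1) x], then [S^d x] and [S^(d+j) u] differ by
    an element of [N(S) `&` R(S^d)], which lies in [R(S^(d+j))] by
    [stable_null]. *)
Let Rinf_lift y x : Rinf y -> K (y - S x) -> Rinf x.
Proof.
move=> hy; rewrite /K /null_space /= (linear_mapB (linear_iter lS d)) => /eqP.
rewrite subr_eq0 => /eqP yx j.
have [u _] := hy j.+1; rewrite yx addnS => ux.
change (range (iter (d + j) S) (iter d S x)).
apply: (@subspace_sub _ _ _ _ (iter (d + j) S u)).
- exact: subspace_power.
- apply: ud.1; split.
    rewrite /null_space /= (linear_mapB lS) -[S (iter d S x)]iterS iterSr.
    by rewrite -[S (iter _ S u)]iterS ux subrr.
  apply: subspaceB; [exact: subspace_power|by exists x|].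
  by apply: range_power_mono (leq_addr j d) _ _; exists u.
- by exists u.
Qed.

Let solve_rel (A : set X) a : set (X * X) := [set p | A p.1 /\ K (p.2 - shift S a p.1)].

Let solve_rel_closed A a : norm_closed nm A ->
  norm_closed (prod_norm nm nm) (solve_rel A a).
Proof.
move=> cA; apply: norm_closedI.
  apply: (@norm_closed_preimage _ _ _ _ nm fst _ 1 _ _ cA) => // p q.
  by rewrite /prod_norm /= mul1r; have := nm_ge0 (p.2 - q.2); lra.
have [c c0 hc] := bS.2.
have m0 := modulus_ge0 a.
apply: (@norm_closed_preimage _ _ _ _ nm
  (fun p : X * X => p.2 - shift S a p.1) _ (1 + c + modulus a) _ _ cK); first by lra.
move=> p q; rewrite /prod_norm /=.
rewrite [X in nm X <= _](_ : _ = (p.2 - q.2) - shift S a (p.1 - q.1)); last first.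
  by rewrite (linear_mapB (linear_shift a lS)); lmod.
apply: le_trans (bnormB bnm _ _) _.
have : nm (shift S a (p.1 - q.1)) <= c * nm (p.1 - q.1) + modulus a * nm (p.1 - q.1).
  apply: le_trans (bnormB bnm _ _) _; rewrite (bnormZ bnm).
  by apply: lerD.
have := nm_ge0 (p.1 - q.1); have := nm_ge0 (p.2 - q.2).
move=> h1 h2; have := mulr_ge0 c0 h1; have := mulr_ge0 m0 h1.
by rewrite !mulrDl !mulrDr !mul1r; lra.
Qed.

Let subspace_solve_rel A a : is_subspace A -> is_subspace (solve_rel A a).
Proof.
move=> sA; split.
  split; first exact: subspace0.
  by rewrite /= (linear_map0 (linear_shift a lS)) subrr; exact: subspace0 sK.
move=> b [x y] [x' y'] [/= Ax Kx] [/= Ax' Kx']; split; first exact: sA.2.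
rewrite /= (linear_shift a lS).
rewrite [X in K X](_ : _ = b *: (y - shift S a x) + (y' - shift S a x')); last lmod.
exact: sK.2.
Qed.

Lemma base_bound : exists2 C, 0 < C & forall y, ran 0 y ->
  exists2 x, K (y - S x) & nm x <= C * nm y.
Proof.
have [c c0 hc] := open_mapping bnm bnm (subspace_power_rel bS d 1)
  (@power_rel_closed _ _ _ bS d 1) (eq_ind_r _ (ud.2 1%N) (rel_range_power S d 1)).
exists (c + 1); first by lra.
move=> y [x]; rewrite shift0 => Kx.
have [|u hu nu] := hc y.
  exists x; move/eqP: Kx.
  rewrite (linear_mapB (linear_iter lS d)) subr_eq0 -iterSr => /eqP yx.
  by rewrite /power_rel /= addn1.
exists u; last by have := nm_ge0 y; lra.
move: hu; rewrite /power_rel /= addn1 => hu.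
by rewrite /K /null_space /= (linear_mapB (linear_iter lS d)) hu iterSr subrr.
Qed.

Variable C : R.
Hypotheses (C0 : 0 < C) (hC : forall y, ran 0 y ->
  exists2 x, K (y - S x) & nm x <= C * nm y).

(** A solution of [S x = y] modulo [K] solves [(S - a) x = y] up to the error
    [a x], which is again in the core and at most half as long as [y]. *)
Let core_bound a y : modulus a * C <= 1 / 2 -> Rinf y ->
  exists2 x, Rinf x /\ K (y - shift S a x) & nm x <= 2 * C * nm y.
Proof.
move=> aC Ry.
have [|x [Rx Kx] nx] := @successive_approximation _ _ _ _ _ bnm bnm _
  (subspace_solve_rel a sRinf) (@solve_rel_closed _ a cRinf) Rinf C (ltW C0) _ y Ry.
  move=> {Ry} {}y Ry; have [|x Kx nx] := hC (y := y).
    have [u _] := Ry 1%N; rewrite addn1 iterSr => uy; exists u.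
    by rewrite shift0 /K /null_space /= (linear_mapB (linear_iter lS d)) uy subrr.
  have Rx := Rinf_lift Ry Kx.
  exists x, (y - a *: x); split=> //.
  - split=> //=; rewrite (_ : _ - _ = y - S x) //; rewrite /shift; lmod.
  - by rewrite (_ : _ - _ = a *: x); [exact (subspaceZ a sRinf Rx)|lmod].
  - rewrite (_ : _ - _ = a *: x); last lmod.
    rewrite (bnormZ bnm); have := ler_wpM2l (modulus_ge0 a) nx.
    by have := ler_wpM2r (nm_ge0 y) aC; lra.
by exists x.
Qed.

(** On [ker a] the operator [S - b] acts as the scalar [a - b], so a short
    correction in the core brings a vector of [ker a] into [ker b]. *)
Let ker_gap a b : modulus b * C <= 1 / 2 ->
  gap_le nm (ker a) (ker b) (2 * C * modulus (a - b)).
Proof.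
move=> bC x kx.
have Rx : Rinf ((a - b) *: x) by exact (subspaceZ (a - b) sRinf (ker_Rinf kx)).
have [u [_ Ku] nu] := core_bound bC Rx.
exists (x - u); last first.
  by rewrite (_ : _ - _ = u); [move: nu; rewrite (bnormZ bnm) mulrA|lmod].
rewrite /ker /= [X in K X](_ : _ = shift S a x + ((a - b) *: x - shift S b u)).
  exact: subspaceD.
by rewrite (linear_mapB (linear_shift b lS)) /shift; lmod.
Qed.

(** [S - a] is open onto its range modulo [K], with a bound independent of
    [a]: a nearly shortest preimage [x] of [y] is compared with a preimage [z]
    under [S], from which it differs by an element of [ker 0], that is, nearly
    by an element of [ker a]. *)
Let ran_bound a y : modulus a * C <= 1 / 16 -> ran a y ->
  exists2 x, K (y - shift S a x) & nm x <= 4 * C * nm y.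
Proof.
move=> aC [x0 Kx0].
have cker : norm_closed nm (ker a).
  rewrite (_ : ker a = [set x | solve_rel setT a (x, 0)]); last first.
    apply/seteqP; split=> x; rewrite /ker /solve_rel /= sub0r.
      by move=> h; split=> //; exact: subspaceN.
    by move=> [_ /(subspaceN sK)]; rewrite opprK.
  apply: (@norm_closed_preimage _ _ _ _ (prod_norm nm nm) (fun x => (x, 0)) _ 1 _ _
    (@solve_rel_closed setT a (@norm_closedT _ _ nm))) => // x y'.
  by rewrite /prod_norm /= subrr (bnorm0 bnm) addr0 mul1r.
have [kx0|nkx0] := pselect (ker a x0).
  exists 0; last by rewrite (bnorm0 bnm) !mulr_ge0 // ltW.
  rewrite (linear_map0 (linear_shift a lS)) subr0.
  exact: subspace_sub Kx0 kx0.
have [x [_ xE] hx] := riesz (@subspaceT _ X) (sker a) cker (fun _ _ => I) I nkx0.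
(* riesz only gives the line of x0 modulo ker a: rescale *)
have [b kb] : adjoin (ker a) x x0 by rewrite xE; exact: adjoin_self.
have {}hx w : ker a w -> nm (b *: x) <= 2 * nm (b *: x - w).
  move=> kw; have [->|b0] := eqVneq b 0.
    rewrite scale0r (bnorm0 bnm); have := nm_ge0 (0 - w); lra.
  have := hx (b^-1 *: w) (subspaceZ _ (sker a) kw).
  rewrite -(ler_pM2l (modulus_gt0 b0)) -(bnormZ bnm) => /le_trans; apply.
  rewrite (_ : b *: x - w = b *: (x - b^-1 *: w)); last by lmodf.
  by rewrite (bnormZ bnm) mulrCA.
have Kx : K (y - shift S a (b *: x)).
  rewrite (_ : _ - _ = (y - shift S a x0) + shift S a (x0 - b *: x)).
    exact: subspaceD.
  by rewrite (linear_mapB (linear_shift a lS)); lmod.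
set u := b *: x in hx Kx.
have [|z Kz nz] := hC (y := y + a *: u).
  exists u; rewrite shift0 (_ : _ - _ = y - shift S a u) //.
  by rewrite /shift; lmod.
have ku : ker 0 (u - z).
  rewrite /ker /= shift0 (linear_mapB lS).
  rewrite (_ : _ - _ = (y + a *: u - S z) - (y - shift S a u)); last by rewrite /shift; lmod.
  exact: subspaceB.
have [|w kw nw] := ker_gap (b := a) _ ku; first by lra.
exists u => //.
have := hx _ kw.
have : nm (u - w) <= nm z + nm (u - z - w).
  by apply: le_trans (bnormD bnm _ _); rewrite [X in nm X <= _](_ : _ = z + (u - z - w)) //; lmod.
have : nm (y + a *: u) <= nm y + modulus a * nm u.
  by apply: le_trans (bnormD bnm _ _) _; rewrite (bnormZ bnm).
move=> /(ler_wpM2l (ltW C0)) ny.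
have nuz := bnormB bnm u z.
have := nm_ge0 u; have := nm_ge0 y; have := nm_ge0 z => z0 y0 u0.
have p1 : modulus a * C * nm u <= nm u / 16 by have := ler_wpM2r u0 aC; lra.
move: nw; rewrite sub0r modulusN => nw.
have p2 : 2 * C * modulus a * nm (u - z) <= (nm u + nm z) / 8.
  by have := ler_wpM2r (nm_ge0 (u - z)) aC; lra.
lra.
Qed.

(** Approximating a limit point by elements of the range, and solving for these
    with the bound of [ran_bound], solves for the limit point itself. *)
Let ran_closed a : modulus a * C <= 1 / 16 -> norm_closed nm (ran a).
Proof.
move=> aC y hy.
pose D := [set y | forall e, 0 < e -> exists y', ran a y' /\ nm (y - y') < e].
have [||x [_ Kx] _] := @successive_approximation _ _ _ _ _ bnm bnm _
  (subspace_solve_rel a (@subspaceT _ X)) (@solve_rel_closed setT a (@norm_closedT _ _ nm))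
  D (8 * C) _ _ y hy.
- by rewrite mulr_ge0 // ltW.
- move=> {hy} {}y hy; have [->|y0] := pselect (y = 0).
    exists 0, 0; split; first exact: subspace0 (subspace_solve_rel a (@subspaceT _ X)).
    + by rewrite (bnorm0 bnm) mulr0.
    + rewrite subrr => e e0; exists 0; split; first exact: subspace0.
      by rewrite subrr (bnorm0 bnm).
    + by rewrite subrr (bnorm0 bnm) mul0r.
  have ny := bnorm_gt0 bnm y0.
  have [|b [rb yb]] := hy (nm y / 2); first by lra.
  have [x Kx nx] := ran_bound aC rb.
  exists x, b; split=> //; last exact: ltW.
    have : nm b <= 2 * nm y.
      have := bnormB bnm y (y - b); rewrite opprB addrC subrK; lra.
    by move=> /(ler_wpM2l (ltW C0)); lra.
  move=> e /hy[y' [ry' yy']]; exists (y' - b); split; first exact: subspaceB.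
  by rewrite (_ : _ - _ = y - y') //; lmod.
by exists x.
Qed.

Let ran_gap a b : modulus a * C <= 1 / 16 ->
  gap_le nm (ran a) (ran b) (4 * C * modulus (a - b)).
Proof.
move=> aC y /(ran_bound aC)[x Kx nx].
exists (y + (a - b) *: x).
  by exists x; rewrite (_ : _ - _ = y - shift S a x) // /shift; lmod.
rewrite (_ : _ - _ = - ((a - b) *: x)); last lmod.
rewrite (bnormN bnm) (bnormZ bnm).
have := ler_wpM2l (modulus_ge0 (a - b)) nx; lra.
Qed.

Let radius_mul a : modulus a <= (16 * C)^-1 -> modulus a * C <= 1 / 16.
Proof.
by rewrite -(ler_pM2r C0) => /le_trans; apply; rewrite invfM -mulrA mulVf ?gt_eqF //; lra.
Qed.

Let ker_dimge m a b : modulus a <= (16 * C)^-1 -> modulus b <= (16 * C)^-1 ->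
  dimge (ker a) K m -> dimge (ker b) K m.
Proof.
have [eta eta0 h] := gap_dimge bnm m.
apply: (@small_steps _ (fun a => dimge (ker a) K m) _ (eta / (2 * C))).
  by rewrite divr_gt0 ?mulr_gt0.
move=> {}a {}b ar br ab; apply: h => //.
  move=> x kx; have [|y ky xy] := ker_gap (b := b) _ kx.
    by have := radius_mul br; lra.
  exists y => //; apply: le_trans xy _; apply: ler_wpM2r => //.
  by move: ab; rewrite ler_pdivlMr ?mulr_gt0 // mulrC.
move=> x Kx; exists x => //; rewrite subrr (bnorm0 bnm).
by rewrite mulr_ge0 // ltW.
Qed.

Let ran_dimge m a b : modulus a <= (16 * C)^-1 -> modulus b <= (16 * C)^-1 ->
  dimge setT (ran a) m -> dimge setT (ran b) m.
Proof.
have [eta eta0 h] := gap_dimge bnm m.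
apply: (@small_steps _ (fun a => dimge setT (ran a) m) _ (eta / (4 * C))).
  by rewrite divr_gt0 ?mulr_gt0.
move=> {}a {}b ar br ab; apply: h => //.
- exact/ran_closed/radius_mul.
- by move=> x _; exists x => //; rewrite subrr (bnorm0 bnm) mulr_ge0 // ltW.
- move=> x rx; have [|y ky xy] := ran_gap a _ rx; first exact: radius_mul.
  exists y => //; apply: le_trans xy _; apply: ler_wpM2r => //.
  by move: ab; rewrite ler_pdivlMr ?mulr_gt0 // mulrC -modulusN opprB.
Qed.

(** [S] is nilpotent on [K], so [S - a] maps [K] onto itself. *)
Lemma null_shift_range a n : a != 0 -> K `<=` range (iter n (shift S a)).
Proof.
move=> a0.
have step m x : iter m S x = 0 -> exists2 u, iter m S u = 0 & x = shift S a u.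
  elim: m x => [|m IH] x.
    by move=> /= ->; exists 0 => //; rewrite /shift scaler0 subr0 (linear_map0 lS).
  rewrite iterSr => /IH[u u0 Sx].
  exists (a^-1 *: (u - x)).
    rewrite iterSr (linear_mapZ lS) (linear_mapZ (linear_iter lS m)) (linear_mapB lS).
    rewrite (linear_mapB (linear_iter lS m)) Sx iter_shift u0 -iterSr iterS u0.
    rewrite (linear_map0 lS) (linear_map0 (linear_shift a lS)) subrr scaler0 //.
  rewrite (linear_mapZ (linear_shift a lS)) (linear_mapB (linear_shift a lS)) -Sx.
  by rewrite /shift; lmodf.
elim: n => [|n IH] x Kx; first by exists x.
have [u u0 ->] := step _ _ Kx.
by have [w _ <-] := IH _ u0; exists w.
Qed.

Lemma small_shift a : a != 0 -> modulus a <= (16 * C)^-1 ->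
  [/\ stable_null (shift S a) 0, norm_closed nm (range (shift S a)),
    forall m, hasdim (null_space (shift S a)) [set 0] m <->
              hasdim (null_space S `&` range (iter d S)) [set 0] m
  & forall m, hasdim setT (range (shift S a)) m <->
              hasdim (range (iter d S)) (range (iter d.+1 S)) m].
Proof.
move=> a0 ar; have aC := radius_mul ar.
have r0 : modulus 0 <= (16 * C)^-1.
  by rewrite (modulus_real 0) normr0 invr_ge0 mulr_ge0 // ltW.
have la := linear_shift a lS.
have ranE : ran a = range (shift S a).
  apply/seteqP; split=> [y [x Kx]|_ [x _ <-]].
    apply: (@subspace_sub _ _ _ _ (shift S a x)); first exact: subspace_range.
      exact: (null_shift_range 1 a0 Kx).
    by exists x.
  by exists x; rewrite subrr; exact: subspace0 sK.
have Rinf_range n : Rinf `<=` range (iter n (shift S a)).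
  elim: n => [|n IH] y Ry; first by exists y.
  have [|x [Rx Kx] _] := core_bound _ Ry (a := a); first by lra.
  apply: (@subspace_sub _ _ _ _ (shift S a x)); first exact: subspace_power.
    exact: null_shift_range.
  by have [u _ <-] := IH _ Rx; exists u.
have kerE b m : hasdim (ker b) K m <->
    hasdim (null_space (shift S b) `&` range (iter d S)) [set 0] m.
  apply: (@hasdim_iso _ _ _ _ (linear_iter lS d)) => //.
  - apply: subspaceI; last exact: subspace_power.
    exact: (subspace_null1 (linear_shift b lS)).
  - exact: subspace_set0.
  - move=> x kx; split; last by exists x.
    by rewrite /null_space /= -iter_shift.
  - move=> y [Sy [x _ xy]]; exists x; last by rewrite xy /= subrr.
    by rewrite /ker /K /null_space /= iter_shift xy.
split.
- move=> n x [ax _]; apply: Rinf_range; apply: (@ker_Rinf a).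
  rewrite /ker /= ax; exact: subspace0.
- by rewrite -ranE; exact: ran_closed.
- move=> m.
  rewrite (_ : null_space (shift S a) = null_space (shift S a) `&` range (iter d S)).
    rewrite -kerE (_ : null_space S = null_space (shift S 0)) ?kerE -?kerE; last first.
      by apply/seteqP; split=> x; rewrite /null_space /= shift0.
    apply: hasdim_from_dimge => // k; split; exact: ker_dimge.
  apply/seteqP; split=> x; last by case.
  move=> ax; split=> //.
  have Sx : S x = a *: x by apply/eqP; rewrite -subr_eq0; exact/eqP.
  exists (a^-1 ^+ d *: x) => //; rewrite (linear_mapZ (linear_iter lS d)).
  elim: (d) => [|j IH]; first by rewrite expr0 scale1r.
  rewrite iterSr Sx (linear_mapZ (linear_iter lS j)) scalerA exprSr -mulrA.
  by rewrite mulVf // mulr1.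
- move=> m; rewrite -ranE.
  have -> : hasdim setT (ran a) m <-> hasdim setT (ran 0) m.
    apply: hasdim_from_dimge => // k; split; exact: ran_dimge.
  apply: (@hasdim_iso _ _ _ _ (linear_iter lS d)) => //.
  - exact: subspace_power.
  - exact: subspace_power.
  - move=> _ [x _ <-]; exists x => //; rewrite subrr.
    exact: subspace0 (subspace_power lS _).
  - move=> y _; split=> [[x]|[x _ xy]].
      rewrite shift0 /K /null_space /= (linear_mapB (linear_iter lS d)) => /eqP.
      by rewrite subr_eq0 -iterSr => /eqP ->; exists x.
    by exists x; rewrite shift0 /K /null_space /= (linear_mapB (linear_iter lS d)) -iterSr xy subrr.
Qed.

End LocalConstancy.

Section LocalConstancyTheorem.
Variables (R : realType) (X : completeNormedModType R[i]).

(** The punctured neighbourhood theorem at a point of uniform descent. By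
    [small_shift] the numbers for [S - a] at the power 0 agree with those for [S]
    at [d], and by the first conclusion they are the same at all powers. *)
Theorem local_constancy (S : X -> X) d : bounded_linear S -> uniform_descent S d ->
  exists2 r : R, 0 < r & forall a, a != 0 -> modulus a < r ->
  [/\ stable_null (shift S a) 0, norm_closed (@nm R X) (range (shift S a)),
    forall n m, hasdim (null_space (shift S a) `&` range (iter n (shift S a))) [set 0] m <->
              hasdim (null_space S `&` range (iter d S)) [set 0] m
  & forall n m, hasdim (range (iter n (shift S a))) (range (iter n.+1 (shift S a))) m <->
              hasdim (range (iter d S)) (range (iter d.+1 S)) m].
Proof.
move=> bS ud; have [C C0 hC] := base_bound bS ud.
exists (16 * C)^-1; first by rewrite invr_gt0 mulr_gt0.
move=> a a0 /ltW ar; have [h1 h2 h3 h4] := small_shift bS ud C0 hC a0 ar.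
have la := linear_shift a bS.1.
have range0 : range (iter 0 (shift S a)) = setT by exact: image_id.
split=> // n m.
  by rewrite (stable_null_power h1) // range0 setIT.
by rewrite (stable_null_range la _ h1) // range0.
Qed.

End LocalConstancyTheorem.

(** * Which powers have closed range *)

Section ClosedPowers.
Variables (R : realType) (X : completeNormedModType R[i]) (S : X -> X).
Local Notation nm := (@nm R X).
Local Notation bnm := (@banach_nm R X).
Hypothesis bS : bounded_linear S.
Let lS : linear_map S := bS.1.
Implicit Types (m n d j p : nat).
Local Notation Rg n := (range (iter n S)).
Local Notation N := (null_space S).

Let sRg n : is_subspace (Rg n) := subspace_power lS n.
Let sN : is_subspace N := subspace_null1 lS.

(** Backwards: [N(S) + R(S^p)] is the preimage of [R(S^(p+1))] under [S], so
    [rel_range_closed] gives closedness of [R(S^p)]. Forwards: [S] is open from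
    [R(S^p)] onto [R(S^(p+1))], and [R(S^n)] contains the kernel of this map after
    a finite-dimensional enlargement, which changes neither its closedness nor
    its image [R(S^(n+1))]. *)
Lemma closed_powers_up p : norm_closed nm (Rg p.+1) -> norm_closed nm (N `&` Rg p) ->
  (forall n, (p <= n)%N -> findim (N `&` Rg p) (N `&` Rg n)) ->
  forall n, (p <= n)%N -> norm_closed nm (Rg n).
Proof.
move=> c1 cN fN.
have cp : norm_closed nm (Rg p).
  rewrite range_power_rel.
  apply: (rel_range_closed bnm bnm
    (subspace_power_rel bS 0 p) (@power_rel_closed _ _ _ bS 0 p) sN
    (null_closed bS (n := 1))); rewrite -range_power_rel.
    rewrite (_ : addset _ _ = S @^-1` Rg p.+1).
      exact: (power_preimage_closed bS (d := 1) c1).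
    apply/seteqP; split=> [_ [_ [y [[x _ <-] Ny ->]]]|x [u _ ux]].
      by exists x => //; rewrite (linear_mapD lS) Ny addr0.
    exists (iter p S u), (x - iter p S u); split.
    - by exists u.
    - by rewrite /null_space /= (linear_mapB lS) -ux subrr.
    - lmod.
  by rewrite setIC.
move=> n /subnKC <-; elim: (n - p)%N => [|j IH]; first by rewrite addn0.
rewrite addnS; move: (p + j)%N (leq_addr j p) IH => {}n pn cn.
pose A := addset (Rg n) (N `&` Rg p).
have sA : is_subspace A by apply: subspace_addset => //; exact: subspaceI.
have cA : norm_closed nm A.
  apply: (findim_extension_closed bnm sA (sRg n) cn).
    by move=> x Rx; exists x, 0; rewrite addr0; split=> //; apply: subspace0; exact: subspaceI.
  have [k hk] := fN n pn; exists k.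
  apply: (hasdim_addset k (subspaceI sN (sRg p)) (sRg n) _).1 hk.
  by move=> x [Nx _]; split=> [[]|].
pose G := [set q : X * X | Rg p q.1 /\ q.2 = S q.1].
have GE : rel_range G = Rg p.+1.
  apply/seteqP; split=> [y [x []]|_ [u _ <-]]; first by move=> /= [u _ <-] ->; exists u.
  by exists (iter p S u); split=> //; exists u.
have -> : Rg n.+1 = [set y | exists2 x, A x & G (x, y)].
  apply/seteqP; split=> [_ [u _ <-]|y [_ [_ [v [[u _ <-] [Nv _] ->]]] []]].
    exists (iter n S u).
      exists (iter n S u), 0; rewrite addr0; split=> //.
      by apply: subspace0; exact: subspaceI.
    by split=> //; apply: (range_power_mono pn); exists u.
  by move=> /= _ ->; exists u => //; rewrite (linear_mapD lS) Nv addr0.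
apply: (image_closed bnm bnm (G := G)) => //.
- split; first by split; [exact: subspace0|rewrite /= (linear_map0 lS)].
  move=> a [x y] [x' y'] [] /= Rx -> [] /= Rx' ->; split; first exact: (sRg p).2.
  by rewrite /= lS.
- rewrite (_ : G = (fst @^-1` Rg p) `&` power_rel S 0 1).
    apply: norm_closedI; last exact: power_rel_closed.
    apply: (@norm_closed_preimage _ _ _ _ nm fst _ 1 _ _ cp) => // q q'.
    by rewrite /prod_norm /= mul1r; have := bnorm_ge0 bnm (q.2 - q'.2); lra.
  by apply/seteqP; split=> -[x y] [].
- by rewrite GE.
- move=> x [/= Rx /esym Nx]; exists 0, x; rewrite add0r; split=> //.
  exact: subspace0.
Qed.

(** [R(S^m) + N(S^d)] is closed by uniform descent, and [R(S^m)] meets [N(S^d)] in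
    a space of dimension at most [d] times the dimension of [N(S) `&` R(S^p)]. *)
Lemma closed_powers_of_uniform_descent d p : uniform_descent S d ->
  findim (N `&` Rg p) [set 0] -> forall m, (p <= m)%N -> norm_closed nm (Rg m).
Proof.
move=> ud fN m pm.
have fK j : findim (null_space (iter j S) `&` Rg m) [set 0].
  have sK i : is_subspace (null_space (iter i S) `&` Rg m).
    by apply: subspaceI => //; exact: subspace_null.
  elim: j => [|j [k hk]]; first by exists 0%N => x [].
  pose V' := iter j S @` (null_space (iter j.+1 S) `&` Rg m).
  have V'N : V' `<=` N `&` Rg p.
    move=> _ [x [Kx [u _ ux]] <-]; split; first exact: Kx.
    apply: (range_power_mono (leq_trans pm (leq_addl j m))).
    by exists u => //; rewrite iterD ux.
  have [k' hk'] := findim_mono (@subspace_set0 _ X) (@subset_refl _ _) V'N fN.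
  exists (k + k')%N; apply: (hasdim_add _ (sK j)) hk.
  - by move=> _ ->; exact: subspace0.
  - have iso : hasdim (null_space (iter j.+1 S) `&` Rg m)
        (null_space (iter j S) `&` Rg m) k' <-> hasdim V' [set 0] k'.
      apply: (@hasdim_iso _ _ _ _ (linear_iter lS j)) => //.
      + exact: (subspace_image (linear_iter lS j)).
      + exact: subspace_set0.
      + by move=> x h; exists x.
      + by move=> _ [x h <-]; exists x => //; rewrite /= subrr.
      + by move=> x [_ Rx]; split=> [[]|].
    exact/iso.
  - by move=> x [Kx Rx]; split=> //; apply: (null_mono lS (leqnSn j)).
rewrite range_power_rel.
apply: (rel_range_closed bnm bnm
    (subspace_power_rel bS 0 m) (@power_rel_closed _ _ _ bS 0 m)
    (subspace_null lS d) (null_closed bS (n := d))); rewrite -range_power_rel.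
  rewrite (_ : addset _ _ = power_preimage S d m); first exact: ud.2.
  apply/seteqP; split=> [_ [_ [y [[x _ <-] Ky ->]]]|x [u _ ux]].
    by exists x => //; rewrite (linear_mapD (linear_iter lS d)) Ky addr0 iterD.
  exists (iter m S u), (x - iter m S u); split; [by exists u| |lmod].
  by rewrite /null_space /= (linear_mapB (linear_iter lS d)) -iterD ux subrr.
rewrite setIC; apply: (findim_closed bnm) (fK d).
by apply: subspaceI => //; exact: subspace_null.
Qed.

(** * Finite defects become stationary *)

Lemma stable_null_of_findim p : findim (N `&` Rg p) [set 0] ->
  exists2 d, (p <= d)%N & stable_null S d.
Proof.
move=> fp.
have fin n : (p <= n)%N -> findim (N `&` Rg n) [set 0].
  move=> pn; apply: findim_mono fp => //; first exact: subspace_set0.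
  by move=> x [Nx Rx]; split=> //; exact: range_power_mono Rx.
(* [d] realises the least dimension *)
pose P k := `[< exists2 n, (p <= n)%N & hasdim (N `&` Rg n) [set 0] k >].
have exP : exists k, P k by have [k hk] := fp; exists k; apply/asboolP; exists p.
have [k /asboolP[d pd hk] kmin] := ex_minnP exP.
exists d => //; apply: stable_null_steps => n dn.
have [k' hk'] := fin n.+1 (leq_trans pd (leqW dn)).
have kk' : (k <= k')%N.
  by apply: kmin; apply/asboolP; exists n.+1 => //; exact: leq_trans pd (leqW dn).
have sub : N `&` Rg n.+1 `<=` N `&` Rg d.
  by move=> x [Nx Rx]; split=> //; apply: range_power_mono Rx; exact: leqW.
have [j hj] : findim (N `&` Rg d) (N `&` Rg n.+1).
  apply: (@findim_mono _ _ _ _ _ [set 0] (@subspace_set0 _ X) _ (@subset_refl _ _)).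
    by move=> _ ->; apply: subspace0; exact: subspaceI.
  by exists k.
have := hasdim_inj (@subspace_set0 _ X) hk
  (hasdim_add _ (subspaceI sN (sRg n.+1)) hj sub hk').
case: j hj => [h _ x [Nx Rx]|j _ e].
  have [] // := h x; split=> //; exact: range_power_mono Rx.
have : (k' < k)%N.
  rewrite e ?addnS ?ltnS ?leq_addr // => _ ->.
  by apply: subspace0; exact: subspaceI.
by rewrite ltnNge kk'.
Qed.

Lemma hasdim_kernel_defect n k :
  hasdim (N `&` Rg n) (N `&` Rg n.+1) k <->
  hasdim (addset (Rg n.+1) (N `&` Rg n)) (Rg n.+1) k.
Proof.
apply: hasdim_addset => //; first exact: subspaceI.
by move=> x [Nx _]; split=> [[]|].
Qed.

Lemma hasdim_range_defect n k :
  hasdim (Rg n) (addset (Rg n.+1) (N `&` Rg n)) k <-> hasdim (Rg n.+1) (Rg n.+2) k.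
Proof.
apply: (@hasdim_iso _ _ _ _ lS) => //.
- by move=> _ [u _ <-]; exists u.
- move=> _ [u _ <-]; exists (iter n S u); first by exists u.
  by rewrite subrr; exact: subspace0.
- move=> x Rx; split=> [[_ [v [[u _ <-] [Nv _] ->]]]|[u _ ux]].
    by exists u => //; rewrite (linear_mapD lS) Nv addr0.
  exists (iter n.+1 S u), (x - iter n.+1 S u); split; [by exists u| |lmod].
  split; first by rewrite /null_space /= (linear_mapB lS) -ux subrr.
  by apply: subspaceB => //; exists (S u) => //; rewrite -iterSr.
Qed.

Lemma subspace_range_null n : is_subspace (addset (Rg n.+1) (N `&` Rg n)).
Proof. by apply: subspace_addset => //; exact: subspaceI. Qed.

Lemma range_sub_range_null n : Rg n.+1 `<=` addset (Rg n.+1) (N `&` Rg n).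
Proof.
by move=> x Rx; exists x, 0; rewrite addr0; split=> //; apply: subspace0; exact: subspaceI.
Qed.

Lemma range_null_sub_range n : addset (Rg n.+1) (N `&` Rg n) `<=` Rg n.
Proof.
move=> _ [x [y [Rx [_ Ry] ->]]]; apply: subspaceD => //.
exact: range_power_mono Rx.
Qed.

(** With [U = R(S^(n+1)) + N(S) `&` R(S^n)], the quotient [R(S^n) / U] is mapped by
    [S] onto [R(S^(n+1)) / R(S^(n+2))], and [U / R(S^(n+1))] has dimension
    [k_n]. *)
Lemma range_defect_step n b : hasdim (Rg n) (Rg n.+1) b ->
  exists k b', [/\ hasdim (N `&` Rg n) (N `&` Rg n.+1) k,
    hasdim (Rg n.+1) (Rg n.+2) b' & b = (k + b')%N].
Proof.
move=> hb; have fb : findim (Rg n) (Rg n.+1) by exists b.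
have [k hk] := findim_mono (sRg n.+1) (@subset_refl _ _) (@range_null_sub_range n) fb.
have [b' hb'] := findim_mono (sRg n.+1) (@range_sub_range_null n) (@subset_refl _ _) fb.
exists k, b'; split; [exact/hasdim_kernel_defect|exact/hasdim_range_defect|].
exact: hasdim_inj (sRg n.+1) hb (hasdim_add (@range_sub_range_null n)
  (subspace_range_null n) hb' (@range_null_sub_range n) hk).
Qed.

Lemma findim_range p : findim (Rg p) (Rg p.+1) ->
  forall m n, (p <= m)%N -> (m <= n)%N -> findim (Rg m) (Rg n).
Proof.
move=> fp; have fS m : (p <= m)%N -> findim (Rg m) (Rg m.+1).
  move=> /subnKC <-; elim: (m - p)%N => [|j [b]]; first by rewrite addn0.
  by rewrite addnS => /range_defect_step[_ [b' [_ hb' _]]]; exists b'.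
move=> m n pm /subnKC <-; elim: (n - m)%N => [|j [a ha]].
  by rewrite addn0; exists 0%N.
have [b hb] := fS (m + j)%N (leq_trans pm (leq_addr j m)).
exists (b + a)%N; rewrite addnS; apply: (hasdim_add _ (sRg _) ha _ hb).
  exact: range_power_mono.
by apply: range_power_mono; exact: leq_addr.
Qed.

Lemma stable_null_of_findim_range p : findim (Rg p) (Rg p.+1) ->
  exists2 d, (p <= d)%N & stable_null S d.
Proof.
move=> [b0 hb0].
pose P k := `[< exists2 n, (p <= n)%N & hasdim (Rg n) (Rg n.+1) k >].
have exP : exists k, P k by exists b0; apply/asboolP; exists p.
have [b /asboolP[d pd hb] bmin] := ex_minnP exP.
(* the least defect persists, so every later k_n vanishes *)
have step n : (d <= n)%N -> hasdim (Rg n) (Rg n.+1) b ->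
    N `&` Rg n `<=` N `&` Rg n.+1 /\ hasdim (Rg n.+1) (Rg n.+2) b.
  move=> dn /range_defect_step[k [b' [hk hb' e]]].
  have bb' : (b <= b')%N.
    by apply: bmin; apply/asboolP; exists n.+1 => //; exact: leq_trans pd (leqW dn).
  have k0 : k = 0%N by apply/eqP; rewrite -leqn0 -(leq_add2r b') -e.
  by rewrite k0 in e hk; rewrite e; split.
have all n : (d <= n)%N -> hasdim (Rg n) (Rg n.+1) b.
  move=> /subnKC <-; elim: (n - d)%N => [|j IH]; first by rewrite addn0.
  by rewrite addnS; have [] := step _ (leq_addr j d) IH.
exists d => //; apply: stable_null_steps => n dn x Nx.
by have [/(_ x Nx)[]] := step n dn (all n dn).
Qed.

Lemma uniform_descent_of_closed d : stable_null S d ->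
  (forall n, (d <= n)%N -> norm_closed nm (Rg n)) -> uniform_descent S d.
Proof.
move=> sd cl; split=> // j; apply: power_preimage_closed => //.
by apply: cl; exact: leq_addr.
Qed.

(** [S^-d (R(S^(d+j)))] is the range of a closed relation and has finite
    codimension in the whole space, hence it is closed. *)
Lemma uniform_descent_of_findim_range p : findim (Rg p) (Rg p.+1) ->
  exists d, uniform_descent S d.
Proof.
move=> fp; have [d pd sd] := stable_null_of_findim_range fp.
exists d; split=> // j; rewrite -rel_range_power.
apply: (rel_range_finite_codim_closed bnm _ _ (@subspaceT _ X)) => //.
- exact: subspace_power_rel.
- exact: power_rel_closed.
rewrite rel_range_power.
have [k hk] := findim_range fp pd (leq_addr j d); exists k.
have iso : hasdim setT (power_preimage S d j) k <-> hasdim (Rg d) (Rg (d + j)) k.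
  apply: (@hasdim_iso _ _ _ _ (linear_iter lS d)) => //.
  move=> _ [x _ <-]; exists x => //; rewrite subrr; exact: subspace0.
exact/iso.
Qed.

Lemma closed_powers_of_findim_range p : norm_closed nm (Rg p) ->
  findim (Rg p) (Rg p.+1) -> forall n, (p <= n)%N -> norm_closed nm (Rg n).
Proof.
move=> cp fp n pn; have fn := findim_range fp (leqnn p) pn.
rewrite (range_power_rel S n) in fn *.
apply: (rel_range_finite_codim_closed bnm _ _ (sRg p) cp _ fn).
- exact: subspace_power_rel.
- exact: power_rel_closed.
- by rewrite -range_power_rel; exact: range_power_mono.
Qed.

(** * Quasi-Fredholm operators *)

Lemma quasi_FredholmP : quasi_Fredholm S <->
  exists2 d, stable_null S d & forall n, (d <= n)%N -> norm_closed nm (Rg n).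
Proof.
split=> [[d [/(stable_nullP lS) sd /nm_closed cd]]|[d sd cd]].
  exists d => //; apply: closed_powers_up => //.
    rewrite -(stable_null_power sd (leqnSn d)).
    exact: norm_closedI (null_closed bS (n := 1)) cd.
  by move=> n dn; exists 0%N => x Nx; rewrite (stable_null_power sd dn).
by exists d; split; [exact/(stable_nullP lS)|exact/nm_closed/cd].
Qed.

Lemma quasi_Fredholm_of_findim_null p : norm_closed nm (Rg p.+1) ->
  findim (N `&` Rg p) [set 0] -> quasi_Fredholm S.
Proof.
move=> cp fp; apply/quasi_FredholmP.
have [d pd sd] := stable_null_of_findim fp; exists d => // n dn.
apply: (closed_powers_up cp) (leq_trans pd dn).
  by apply: (findim_closed bnm) fp; exact: subspaceI.
move=> m _; apply: findim_mono fp => //; first exact: subspace_set0.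
by move=> _ ->; apply: subspace0; exact: subspaceI.
Qed.

Lemma quasi_Fredholm_of_findim_range p : norm_closed nm (Rg p) ->
  findim (Rg p) (Rg p.+1) -> quasi_Fredholm S.
Proof.
move=> cp fp; apply/quasi_FredholmP.
have [d pd sd] := stable_null_of_findim_range fp; exists d => // n dn.
exact: closed_powers_of_findim_range cp fp _ (leq_trans pd dn).
Qed.

Lemma quasi_Fredholm_TUD : quasi_Fredholm S -> topological_uniform_descent S.
Proof.
move=> /quasi_FredholmP[d sd cd]; apply/(uniform_descentP bS); exists d.
exact: uniform_descent_of_closed.
Qed.

Lemma quasi_Fredholm_closed m p : quasi_Fredholm S -> (p <= m)%N ->
  findim (Rg p) (Rg p.+1) -> norm_closed nm (Rg m).
Proof.
move=> /quasi_FredholmP[d _ cd] pm fp.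
apply: (findim_extension_closed bnm (sRg m) (sRg (maxn d m))).
- exact/cd/leq_maxl.
- exact/range_power_mono/leq_maxr.
- exact (findim_range fp pm (leq_maxr d m)).
Qed.

End ClosedPowers.

(** * Ascents, descents and indices *)

Section Classes.
Variables (R : realType) (X : completeNormedModType R[i]) (S : X -> X).
Local Notation nm := (@nm R X).
Local Notation bnm := (@banach_nm R X).
Hypothesis bS : bounded_linear S.
Let lS : linear_map S := bS.1.
Implicit Types (m n d j p : nat).
Local Notation Rg n := (range (iter n S)).
Local Notation N := (null_space S).

Let sRg n : is_subspace (Rg n) := subspace_power lS n.
Let sN : is_subspace N := subspace_null1 lS.
Let sNRg n : is_subspace (N `&` Rg n) := subspaceI sN (sRg n).
Let s0 : is_subspace [set (0 : X)] := @subspace_set0 _ X.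

Lemma ascentE : ascent S = nat_inf R [set n | hasdim (N `&` Rg n) [set 0] 0].
Proof.
congr nat_inf; apply/seteqP; split=> n h.
  apply: (hasdim_null_power lS n 0).1.
  have {}h : null_space (iter n S) = null_space (iter n.+1 S) := h.
  by move=> x; rewrite h.
apply/seteqP; split; first exact: null_mono.
exact: (hasdim_null_power lS n 0).2 h.
Qed.

Lemma descentE : descent S = nat_inf R [set n | hasdim (Rg n) (Rg n.+1) 0].
Proof.
congr nat_inf; apply/seteqP; split=> n h.
  have {}h : Rg n = Rg n.+1 := h.
  by move=> x; rewrite h.
by apply/seteqP; split=> //; exact: range_power_mono.
Qed.

Lemma ess_ascentE : ess_ascent S = nat_inf R [set n | findim (N `&` Rg n) [set 0]].
Proof.
have sK n := subspace_null lS n.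
congr nat_inf; apply/seteqP; split=> n.
  move=> /(quotient_dim_findim (sK n.+1) (sK n))[k h].
  by exists k; exact/(hasdim_null_power lS n k).
move=> [k h]; apply/(quotient_dim_findim (sK n.+1) (sK n)).
by exists k; exact/(hasdim_null_power lS n k).
Qed.

Lemma ess_descentE : ess_descent S = nat_inf R [set n | findim (Rg n) (Rg n.+1)].
Proof.
by congr nat_inf; apply/seteqP; split=> n /(quotient_dim_findim (sRg n) (sRg n.+1)).
Qed.

Lemma left_Drazin_quasi_Fredholm : left_Drazin S -> quasi_Fredholm S.
Proof.
move=> [n []]; rewrite ascentE => /nat_inf_eq hn /nm_closed cn.
by apply: quasi_Fredholm_of_findim_null cn _ => //; exists 0%N.
Qed.

Lemma left_ess_Drazin_quasi_Fredholm : left_ess_Drazin S -> quasi_Fredholm S.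
Proof.
move=> [n []]; rewrite ess_ascentE => /nat_inf_eq hn /nm_closed cn.
exact: quasi_Fredholm_of_findim_null cn hn.
Qed.

Lemma right_Drazin_quasi_Fredholm : right_Drazin S -> quasi_Fredholm S.
Proof.
move=> [n []]; rewrite descentE => /nat_inf_eq hn /nm_closed cn.
by apply: quasi_Fredholm_of_findim_range cn _ => //; exists 0%N.
Qed.

Lemma right_ess_Drazin_quasi_Fredholm : right_ess_Drazin S -> quasi_Fredholm S.
Proof.
move=> [n []]; rewrite ess_descentE => /nat_inf_eq hn /nm_closed cn.
exact: quasi_Fredholm_of_findim_range cn hn.
Qed.

Lemma left_Drazin_of_uniform_descent d n : uniform_descent S d ->
  hasdim (N `&` Rg n) [set 0] 0 -> left_Drazin S.
Proof.
move=> ud hn.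
have [p [hp _ e]] := @nat_inf_attained R [set n | hasdim (N `&` Rg n) [set 0] 0]
  (ex_intro _ n hn).
exists p; rewrite ascentE e; split=> //; apply/nm_closed.
by apply: (closed_powers_of_uniform_descent bS ud _ (leqnSn p)); exists 0%N.
Qed.

Lemma left_ess_Drazin_of_uniform_descent d n : uniform_descent S d ->
  findim (N `&` Rg n) [set 0] -> left_ess_Drazin S.
Proof.
move=> ud hn.
have [p [hp _ e]] := @nat_inf_attained R [set n | findim (N `&` Rg n) [set 0]]
  (ex_intro _ n hn).
exists p; rewrite ess_ascentE e; split=> //; apply/nm_closed.
exact: (closed_powers_of_uniform_descent bS ud hp (leqnSn p)).
Qed.

Lemma right_Drazin_of_quasi_Fredholm : quasi_Fredholm S ->
  (descent S < +oo)%E -> right_Drazin S.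
Proof.
move=> qS; rewrite descentE => /nat_inf_fin/(nat_inf_attained R)[p [hp _ e]].
exists p; rewrite descentE e; split=> //; apply/nm_closed.
by apply: (quasi_Fredholm_closed bS qS (leqnn p)); exists 0%N.
Qed.

Lemma right_ess_Drazin_of_quasi_Fredholm : quasi_Fredholm S ->
  (ess_descent S < +oo)%E -> right_ess_Drazin S.
Proof.
move=> qS; rewrite ess_descentE => /nat_inf_fin/(nat_inf_attained R)[p [hp _ e]].
exists p; rewrite ess_descentE e; split=> //; apply/nm_closed.
exact: (quasi_Fredholm_closed bS qS (leqnn p)).
Qed.

Lemma descent_TUD : (descent S < +oo)%E -> topological_uniform_descent S.
Proof.
rewrite descentE => /nat_inf_fin[n hn]; apply/(uniform_descentP bS).
by apply: (@uniform_descent_of_findim_range _ _ _ bS n); exists 0%N.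
Qed.

Lemma ess_descent_TUD : (ess_descent S < +oo)%E -> topological_uniform_descent S.
Proof.
rewrite ess_descentE => /nat_inf_fin[n hn]; apply/(uniform_descentP bS).
exact: (@uniform_descent_of_findim_range _ _ _ bS n).
Qed.

Lemma upper_semi_BFredholm_atP n : upper_semi_BFredholm_at S n <->
  [/\ norm_closed nm (Rg n), findim (N `&` Rg n) [set 0] & norm_closed nm (Rg n.+1)].
Proof.
rewrite /upper_semi_BFredholm_at /upper_semi_Fredholm_on range_powerS /nullity_on /Defs.dim.
rewrite !nm_closed quotient_dim_findim //.
by split=> [[? []]|[]].
Qed.

Lemma lower_semi_BFredholm_atP n : lower_semi_BFredholm_at S n <->
  norm_closed nm (Rg n) /\ findim (Rg n) (Rg n.+1).
Proof.
rewrite /lower_semi_BFredholm_at /lower_semi_Fredholm_on /deficiency_on range_powerS.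
by rewrite nm_closed quotient_dim_findim.
Qed.

Lemma BFredholm_atP n : BFredholm_at S n <->
  upper_semi_BFredholm_at S n /\ lower_semi_BFredholm_at S n.
Proof. by split=> [[c [u l]]|[[c u] [_ l]]]. Qed.

Lemma upper_semi_BFredholm_quasi_Fredholm : upper_semi_BFredholm S -> quasi_Fredholm S.
Proof.
move=> [n /upper_semi_BFredholm_atP[_ fn cn]].
exact: quasi_Fredholm_of_findim_null cn fn.
Qed.

Lemma lower_semi_BFredholm_quasi_Fredholm : lower_semi_BFredholm S -> quasi_Fredholm S.
Proof.
move=> [n /lower_semi_BFredholm_atP[cn fn]].
exact: quasi_Fredholm_of_findim_range cn fn.
Qed.

Lemma upper_semi_BFredholm_of_uniform_descent d : uniform_descent S d ->
  findim (N `&` Rg d) [set 0] -> upper_semi_BFredholm_at S d.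
Proof.
move=> ud fd; have h := closed_powers_of_uniform_descent bS ud fd.
by apply/upper_semi_BFredholm_atP; split=> //; apply: h.
Qed.

(** * The index does not depend on the power *)

Lemma quotient_dim_add (U V W : set X) : is_subspace U -> is_subspace V ->
  is_subspace W -> W `<=` U -> U `<=` V ->
  quotient_dim V W = (quotient_dim U W + quotient_dim V U)%E.
Proof.
move=> sU sV sW WU UV.
have q0 A B : is_subspace A -> is_subspace B -> (quotient_dim A B != -oo)%E.
  move=> sA sB; have [[k /(quotient_dim_hasdim _ sA sB) -> //]|h] := pselect (findim A B).
  by rewrite quotient_dim_infinite.
have [[b hb]|fb] := pselect (findim U W); last first.
  rewrite [X in (X + _)%E]quotient_dim_infinite // addye ?q0 //.
  by rewrite quotient_dim_infinite // => h; apply: fb; apply: findim_mono h.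
have [[a ha]|fa] := pselect (findim V U); last first.
  rewrite [X in (_ + X)%E]quotient_dim_infinite // addey ?q0 //.
  by rewrite quotient_dim_infinite // => h; apply: fa; apply: findim_mono h.
have h := hasdim_add WU sU ha UV hb.
move/(quotient_dim_hasdim _ sV sW): h => ->.
move/(quotient_dim_hasdim _ sU sW): hb => ->.
move/(quotient_dim_hasdim _ sV sU): ha => ->.
by rewrite natrD.
Qed.

(** The nullity and the deficiency on [R(S^n)] both drop by [k_n] from [n] to
    [n + 1]. *)
Lemma index_step n : findim (N `&` Rg n) (N `&` Rg n.+1) ->
  index_on (Rg n) S = index_on (Rg n.+1) S.
Proof.
move=> [k hk]; rewrite /index_on /nullity_on /deficiency_on /Defs.dim !range_powerS.
pose U := addset (Rg n.+1) (N `&` Rg n).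
have sU : is_subspace U := subspace_range_null bS n.
have subU : Rg n.+1 `<=` U := @range_sub_range_null _ _ _ bS n.
have Usub : U `<=` Rg n := @range_null_sub_range _ _ _ bS n.
have sub : N `&` Rg n.+1 `<=` N `&` Rg n.
  by move=> x [Nx Rx]; split=> //; exact: range_power_mono Rx.
rewrite (@quotient_dim_add (N `&` Rg n.+1) (N `&` Rg n)) //; last first.
  by move=> _ ->; exact: subspace0.
rewrite (quotient_dim_add sU _ _ subU Usub) //.
have -> : quotient_dim (Rg n) U = quotient_dim (Rg n.+1) (Rg n.+2).
  by apply: quotient_dim_eq => // m; exact: hasdim_range_defect.
rewrite ((quotient_dim_hasdim k _ _).2 hk) //.
move/hasdim_kernel_defect: hk => /(_ bS) hk.
rewrite ((quotient_dim_hasdim k sU _).2 hk) //.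
move: (quotient_dim _ _) (quotient_dim _ _) => [a||] [b||] //=.
by congr _%:E; ring.
Qed.

Lemma index_stable d n : stable_null S d -> (d <= n)%N ->
  index_on (Rg n) S = index_on (Rg d) S.
Proof.
move=> sd dn; rewrite /index_on /nullity_on /deficiency_on /Defs.dim !range_powerS.
rewrite (stable_null_power sd dn); congr (_ - _)%E.
by apply: quotient_dim_eq => // m; exact: stable_null_range.
Qed.

Lemma index_eventually n j :
  findim (N `&` Rg n) [set 0] \/ findim (Rg n) (Rg n.+1) ->
  index_on (Rg n) S = index_on (Rg (n + j)) S.
Proof.
move=> fn; elim: j => [|j IH]; first by rewrite addn0.
rewrite IH addnS; apply: index_step; case: fn => fn.
  apply: findim_mono fn => //; first by move=> _ ->; exact: subspace0.
  by move=> x [Nx Rx]; split=> //; apply: range_power_mono (leq_addr j n) _ Rx.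
have [b hb] := findim_range bS fn (leq_addr j n) (leqnSn _).
by have [k [b' [hk _ _]]] := range_defect_step bS hb; exists k.
Qed.

Lemma Bindex_stable d : stable_null S d ->
  upper_semi_BFredholm S \/ lower_semi_BFredholm S ->
  Bindex S = index_on (Rg d) S.
Proof.
move=> sd sf; rewrite /Bindex; set P := [set n | _]; set n := xget _ _.
have : P n by apply: xgetPex; case: sf => -[m hm]; exists m; [left|right].
rewrite /P /= => Pn; rewrite (@index_eventually n d).
  by rewrite (index_stable sd) // leq_addl.
by case: Pn => [/upper_semi_BFredholm_atP[]|/lower_semi_BFredholm_atP[]]; [left|right].
Qed.

Lemma Bindex_stable0 : stable_null S 0 -> Bindex S = index_on (Rg 0) S.
Proof. by move=> sd; rewrite /Bindex (index_stable sd). Qed.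

End Classes.

(** * Transfer from nearby points *)

Section Transfer.
Variables (R : realType) (X : completeNormedModType R[i]).
Local Notation nm := (@nm R X).
Local Notation bnm := (@banach_nm R X).
Implicit Types (S T : X -> X) (d : nat).

Definition nearby (P : (X -> X) -> Prop) S :=
  forall e : R, 0 < e -> exists a, [/\ a != 0, modulus a < e & P (shift S a)].

(** What [local_constancy] says of [T = S - a]. *)
Definition mirrors T S d :=
  [/\ stable_null T 0, norm_closed nm (range T),
    forall n m, hasdim (null_space T `&` range (iter n T)) [set 0] m <->
              hasdim (null_space S `&` range (iter d S)) [set 0] m
  & forall n m, hasdim (range (iter n T)) (range (iter n.+1 T)) m <->
              hasdim (range (iter d S)) (range (iter d.+1 S)) m].

Lemma bounded_linear_shift S a : bounded_linear S -> bounded_linear (shift S a).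
Proof.
move=> [lS [c c0 hc]]; split; first exact: linear_shift.
exists (c + modulus a); first by rewrite addr_ge0 // modulus_ge0.
move=> x; rewrite mulrDl -(bnormZ bnm).
by apply: le_trans (bnormB bnm _ _) _; rewrite lerD2r.
Qed.

Lemma nearby_mirror P S d : bounded_linear S -> uniform_descent S d -> nearby P S ->
  exists T, [/\ bounded_linear T, P T & mirrors T S d].
Proof.
move=> bS ud nP; have [r r0 hr] := local_constancy bS ud.
have [a [a0 ar Pa]] := nP r r0; exists (shift S a); split=> //.
  exact: bounded_linear_shift.
exact: hr.
Qed.

Section Mirror.
Variables (S T : X -> X) (d : nat).
Hypotheses (bS : bounded_linear S) (bT : bounded_linear T)
  (ud : uniform_descent S d) (TS : mirrors T S d).

Let sdS : stable_null S d := ud.1.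
Let sdT : stable_null T 0. Proof. by case: TS. Qed.

Lemma mirror_null n : findim (null_space T `&` range (iter n T)) [set 0] ->
  findim (null_space S `&` range (iter d S)) [set 0].
Proof. by case: TS => _ _ h _ [k /h]; exists k. Qed.

Lemma mirror_null0 n : hasdim (null_space T `&` range (iter n T)) [set 0] 0 ->
  hasdim (null_space S `&` range (iter d S)) [set 0] 0.
Proof. by case: TS => _ _ h _ /h. Qed.

Lemma mirror_range n : findim (range (iter n T)) (range (iter n.+1 T)) ->
  findim (range (iter d S)) (range (iter d.+1 S)).
Proof. by case: TS => _ _ _ h [k /h]; exists k. Qed.

Lemma mirror_range0 n : hasdim (range (iter n T)) (range (iter n.+1 T)) 0 ->
  hasdim (range (iter d S)) (range (iter d.+1 S)) 0.
Proof. by case: TS => _ _ _ h /h. Qed.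

Lemma mirror_Bindex : upper_semi_BFredholm S \/ lower_semi_BFredholm S ->
  Bindex S = Bindex T.
Proof.
move=> sf; rewrite (Bindex_stable bS sdS sf) (Bindex_stable0 bT sdT).
rewrite /index_on /nullity_on /deficiency_on /Defs.dim !range_powerS.
have sRS n := subspace_power bS.1 n; have sRT n := subspace_power bT.1 n.
have sNS := subspaceI (subspace_null1 bS.1) (sRS d).
have sNT := subspaceI (subspace_null1 bT.1) (sRT 0%N).
case: TS => _ _ h1 h2; congr (_ - _)%E; apply: quotient_dim_eq => //.
- exact: subspace_set0.
- exact: subspace_set0.
- by move=> n; rewrite h1.
- by move=> n; rewrite h2.
Qed.

Lemma mirror_ascent : (ascent T < +oo)%E -> (ascent S < +oo)%E.
Proof.
by rewrite !ascentE // => /nat_inf_fin[n /mirror_null0 h]; apply/nat_inf_fin; exists d.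
Qed.

Lemma mirror_descent : (descent T < +oo)%E -> (descent S < +oo)%E.
Proof.
by rewrite !descentE // => /nat_inf_fin[n /mirror_range0 h]; apply/nat_inf_fin; exists d.
Qed.

Lemma mirror_ess_descent : (ess_descent T < +oo)%E -> (ess_descent S < +oo)%E.
Proof.
by rewrite !ess_descentE // => /nat_inf_fin[n /mirror_range h]; apply/nat_inf_fin; exists d.
Qed.

Lemma mirror_left_Drazin : left_Drazin T -> left_Drazin S.
Proof.
move=> [n []]; rewrite ascentE // => /nat_inf_eq /mirror_null0 h _.
exact: left_Drazin_of_uniform_descent ud h.
Qed.

Lemma mirror_left_ess_Drazin : left_ess_Drazin T -> left_ess_Drazin S.
Proof.
move=> [n []]; rewrite ess_ascentE // => /nat_inf_eq /mirror_null h _.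
exact: left_ess_Drazin_of_uniform_descent ud h.
Qed.

Lemma mirror_upper_semi_BFredholm : upper_semi_BFredholm T -> upper_semi_BFredholm S.
Proof.
move=> [n /(upper_semi_BFredholm_atP bT)[_ /mirror_null h _]]; exists d.
exact: upper_semi_BFredholm_of_uniform_descent.
Qed.

Lemma mirror_BFredholm : BFredholm T -> BFredholm S.
Proof.
move=> [n /BFredholm_atP[/(upper_semi_BFredholm_atP bT)[_ /mirror_null h _]]].
move=> /(lower_semi_BFredholm_atP bT)[_ /mirror_range h']; exists d.
have h1 := upper_semi_BFredholm_of_uniform_descent bS ud h.
apply/BFredholm_atP; split=> //; apply/(lower_semi_BFredholm_atP bS); split=> //.
by case/(upper_semi_BFredholm_atP bS): h1.
Qed.

Lemma mirror_lower_semi_BFredholm : quasi_Fredholm S ->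
  lower_semi_BFredholm T -> lower_semi_BFredholm S.
Proof.
move=> qS [n /(lower_semi_BFredholm_atP bT)[_ /mirror_range h]]; exists d.
apply/(lower_semi_BFredholm_atP bS); split=> //.
exact: (quasi_Fredholm_closed bS qS (leqnn d)).
Qed.

End Mirror.

Lemma BFredholm_upper S : BFredholm S -> upper_semi_BFredholm S.
Proof. by move=> [n /BFredholm_atP[]]; exists n. Qed.

(** * Equality of spectra *)

Lemma boundary_nearby (A : set R[i]) l : A l -> A `<=` boundary A ->
  forall e : R, 0 < e -> exists a, [/\ a != 0, modulus a < e & ~ A (l + a)].
Proof.
move=> Al AA e e0; have [_ nint] := AA _ Al.
apply: contrapT => H; apply: nint.
have e0C : 0 < e%:C%C :> R[i] by rewrite ltcR.
apply/nbhs_ballP; exists e%:C%C => //= z lz.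
apply: contrapT => nAz; apply: H; exists (z - l); split.
- by apply/eqP => /eqP; rewrite subr_eq0 => /eqP zl; apply: nAz; rewrite zl.
- by move: lz; rewrite -ball_normE /= modulusE ltcR -modulusN opprB.
- by rewrite addrC subrK.
Qed.

Lemma shiftD T l a : shift T (l + a) = shift (shift T l) a.
Proof. by apply/funext => x; rewrite /shift scalerDl opprD addrA. Qed.

Lemma spectrum_eq (P Q : (X -> X) -> Prop) T : bounded_linear T ->
  (forall S, bounded_linear S -> P S -> Q S) ->
  (forall S, bounded_linear S -> Q S -> nearby P S -> P S) ->
  spectrum_for P T `<=` boundary (spectrum_for P T) ->
  spectrum_for P T = spectrum_for Q T.
Proof.
move=> bT PQ QP bd; apply/seteqP; split=> l nl h; apply: nl.
  have bl := bounded_linear_shift l bT.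
  apply: contrapT => nPl; apply: (nPl); apply: QP => // e e0.
  have [a [a0 ae /contrapT]] := boundary_nearby nPl bd e0.
  by rewrite shiftD => Pa; exists a.
exact/PQ/h/bounded_linear_shift.
Qed.

Lemma spectrum_TUD (P : (X -> X) -> Prop) T : bounded_linear T ->
  (forall S, bounded_linear S -> P S -> topological_uniform_descent S) ->
  (forall S S' d, bounded_linear S -> bounded_linear S' -> uniform_descent S d ->
     mirrors S' S d -> P S' -> P S) ->
  spectrum_for P T `<=` boundary (spectrum_for P T) ->
  spectrum_for P T = sigma_TUD T.
Proof.
move=> bT PT TP; apply: spectrum_eq => // S bS /(uniform_descentP bS)[d ud] nP.
have [S' [bS' PS' m]] := nearby_mirror bS ud nP.
exact: TP ud m PS'.
Qed.

Lemma sigma_dscE T : sigma_dsc T = spectrum_for (fun S => (descent S < +oo)%E) T.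
Proof.
by apply/seteqP; split=> l; rewrite /sigma_dsc /spectrum_for /= nat_inf_fin nat_inf_oo.
Qed.

Lemma sigma_dsceE T : sigma_dsce T = spectrum_for (fun S => (ess_descent S < +oo)%E) T.
Proof.
by apply/seteqP; split=> l; rewrite /sigma_dsce /spectrum_for /= nat_inf_fin nat_inf_oo.
Qed.

Lemma sigma_RD_qPhi T : bounded_linear T -> sigma_dsc T = sigma_TUD T ->
  sigma_RD T = sigma_qPhi T.
Proof.
move=> bT; rewrite sigma_dscE => e; apply/seteqP; split=> l nl h; apply: nl;
  have bl := bounded_linear_shift l bT.
  apply: right_Drazin_of_quasi_Fredholm => //; apply: contrapT => nd.
  have : spectrum_for (fun S => (descent S < +oo)%E) T l by [].
  by rewrite e; apply; exact: quasi_Fredholm_TUD.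
exact: right_Drazin_quasi_Fredholm.
Qed.

Lemma sigma_RDe_qPhi T : bounded_linear T -> sigma_dsce T = sigma_TUD T ->
  sigma_RDe T = sigma_qPhi T.
Proof.
move=> bT; rewrite sigma_dsceE => e; apply/seteqP; split=> l nl h; apply: nl;
  have bl := bounded_linear_shift l bT.
  apply: right_ess_Drazin_of_quasi_Fredholm => //; apply: contrapT => nd.
  have : spectrum_for (fun S => (ess_descent S < +oo)%E) T l by [].
  by rewrite e; apply; exact: quasi_Fredholm_TUD.
exact: right_ess_Drazin_quasi_Fredholm.
Qed.

Lemma sigma_LD_TUD T : bounded_linear T -> sigma_p T `<=` boundary (sigma_p T) ->
  sigma_LD T = sigma_TUD T.
Proof.
move=> bT bd; apply/seteqP; split=> l nl h; apply: nl;
  have bl := bounded_linear_shift l bT; last first.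
  exact/quasi_Fredholm_TUD/left_Drazin_quasi_Fredholm.
have [d ud] := (uniform_descentP bl).1 h.
have hasdim0 S n : null_space S = [set 0] ->
    hasdim (null_space S `&` range (iter n S)) [set 0] 0.
  by move=> -> x [].
have [pl|npl] := pselect (sigma_p T l); last first.
  apply: (left_Drazin_of_uniform_descent bl (n := 0) ud).
  by apply: hasdim0; apply: contrapT.
have [|S' [bS' h' m]] := @nearby_mirror (fun S => null_space S = [set 0]) _ _ bl ud.
  move=> e e0; have [a [a0 ae /contrapT]] := boundary_nearby pl bd e0.
  by rewrite shiftD => h'; exists a.
apply: (left_Drazin_of_uniform_descent bl ud).
exact: (mirror_null0 m (hasdim0 _ 0%N h')).
Qed.

Lemma sigma_dsc_TUD T : bounded_linear T -> sigma_cp T `<=` boundary (sigma_cp T) ->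
  sigma_dsc T = sigma_TUD T.
Proof.
move=> bT bd; rewrite sigma_dscE; apply/seteqP; split=> l nl h; apply: nl;
  have bl := bounded_linear_shift l bT; last exact: descent_TUD.
set S := shift T l in h bl *.
have [d ud] := (uniform_descentP bl).1 h.
suff hd : hasdim (range (iter d S)) (range (iter d.+1 S)) 0.
  by rewrite descentE //; apply/nat_inf_fin; exists d.
have [cl|/contrapT dl] := pselect (sigma_cp T l).
  have [|S' [bS' h' m]] := @nearby_mirror (fun S => dense (range S)) _ _ bl ud.
    move=> e e0; have [a [a0 ae /contrapT]] := boundary_nearby cl bd e0.
    by rewrite shiftD => h'; exists a.
  apply: (mirror_range0 (n := 0) m) => x _.
  by case: m => _ cS' _ _; apply: cS'; exact: nm_dense.
(* here R(S) is dense, and so is the larger closed space N(S^d) + R(S) *)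
move=> _ [x _ <-].
have : power_preimage S d 1 x.
  apply: ud.2 => e e0; have [y [[u _ <-] xy]] := nm_dense dl x e0.
  by exists (S u); split=> //; exists u => //; rewrite addn1 iterSr.
by rewrite /power_preimage addn1.
Qed.

Lemma sigma_star_TUD T sigma : bounded_linear T ->
  (sigma = @sigma_D R X \/ sigma = @sigma_LD R X \/
   sigma = @sigma_LDe R X \/ sigma = @sigma_BPhi R X \/
   sigma = @sigma_BWplus R X \/ sigma = @sigma_BW R X) ->
  sigma T `<=` boundary (sigma T) -> sigma T = sigma_TUD T.
Proof.
move=> bT [->|[->|[->|[->|[->|->]]]]]; apply: spectrum_TUD => //.
- by move=> S bS [_]; exact: descent_TUD.
- move=> S S' d bS bS' ud m [h1 h2]; split.
    exact: mirror_ascent m h1.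
  exact: mirror_descent m h2.
- by move=> S bS h; exact/quasi_Fredholm_TUD/left_Drazin_quasi_Fredholm.
- by move=> S S' d bS bS' ud m; exact: mirror_left_Drazin ud m.
- by move=> S bS h; exact/quasi_Fredholm_TUD/left_ess_Drazin_quasi_Fredholm.
- by move=> S S' d bS bS' ud m; exact: mirror_left_ess_Drazin ud m.
- move=> S bS /BFredholm_upper h.
  exact/quasi_Fredholm_TUD/upper_semi_BFredholm_quasi_Fredholm.
- by move=> S S' d bS bS' ud m; exact: mirror_BFredholm ud m.
- by move=> S bS [h _]; exact/quasi_Fredholm_TUD/upper_semi_BFredholm_quasi_Fredholm.
- move=> S S' d bS bS' ud m [h i].
  have h' := mirror_upper_semi_BFredholm bS bS' ud m h.
  by split=> //; rewrite (mirror_Bindex bS bS' ud m) //; left.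
- move=> S bS [/BFredholm_upper h _].
  exact/quasi_Fredholm_TUD/upper_semi_BFredholm_quasi_Fredholm.
- move=> S S' d bS bS' ud m [h i].
  have h' := mirror_BFredholm bS bS' ud m h.
  by split=> //; rewrite (mirror_Bindex bS bS' ud m) //; left; exact: BFredholm_upper.
Qed.

Lemma sigma_BWminus_qPhi T : bounded_linear T ->
  sigma_BWminus T `<=` boundary (sigma_BWminus T) ->
  sigma_BWminus T = sigma_qPhi T.
Proof.
move=> bT; apply: spectrum_eq => //.
  by move=> S bS [h _]; exact: lower_semi_BFredholm_quasi_Fredholm.
move=> S bS qS nP.
have [d ud] := (uniform_descentP bS).1 (quasi_Fredholm_TUD bS qS).
have [S' [bS' [h i] m]] := nearby_mirror bS ud nP.
have h' := mirror_lower_semi_BFredholm bS bS' m qS h.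
by split=> //; rewrite (mirror_Bindex bS bS' ud m) //; right.
Qed.

End Transfer.

Theorem corollary4p5 (R : realType) (X : completeNormedModType R[i])
    (T : {linear X -> X}) (infX : infinite_dimensional X)
    (bT : bounded_operator T) :
  (sigma_p T `<=` boundary (sigma_p T) -> sigma_LD T = sigma_TUD T) /\
  (sigma_cp T `<=` boundary (sigma_cp T) ->
    sigma_dsc T = sigma_TUD T /\ sigma_RD T = sigma_qPhi T) /\
  (forall sigma : (X -> X) -> set R[i],
    (sigma = @sigma_D R X \/ sigma = @sigma_LD R X \/
     sigma = @sigma_LDe R X \/ sigma = @sigma_BPhi R X \/
     sigma = @sigma_BWplus R X \/ sigma = @sigma_BW R X) ->
    sigma T = boundary (sigma T) -> sigma T = sigma_TUD T) /\
  (sigma_dsc T = boundary (sigma_dsc T) ->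
    sigma_dsc T = sigma_TUD T /\ sigma_RD T = sigma_qPhi T) /\
  (sigma_dsce T = boundary (sigma_dsce T) ->
    sigma_dsce T = sigma_TUD T /\ sigma_RDe T = sigma_qPhi T) /\
  (sigma_BWminus T = boundary (sigma_BWminus T) ->
    sigma_BWminus T = sigma_qPhi T).
Proof.
have bl : bounded_linear T.
  split; first by move=> a x y; rewrite linearP.
  have [C hC] := bT; exists `|complex.Re C|; first exact: normr_ge0.
  move=> x; apply: le_trans (ler_wpM2r (bnorm_ge0 (@banach_nm R X) x) (ler_norm _)).
  have := hC x; rewrite !nmE lecE => /andP[_] /=.
  by case: (C) => a b /=; rewrite mulr0 subr0.
split; first exact: sigma_LD_TUD.
split.
  move=> bd; have e := sigma_dsc_TUD bl bd.
  by split=> //; exact: sigma_RD_qPhi.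
split.
  by move=> sigma hs bd; apply: sigma_star_TUD => //; rewrite -bd.
split.
  move=> bd; have e : sigma_dsc T = sigma_TUD T.
    rewrite sigma_dscE in bd *; apply: spectrum_TUD => //; last by rewrite -bd.
      by move=> S bS; exact: descent_TUD.
    by move=> S S' d bS bS' ud m; exact: mirror_descent m.
  by split=> //; exact: sigma_RD_qPhi.
split.
  move=> bd; have e : sigma_dsce T = sigma_TUD T.
    rewrite sigma_dsceE in bd *; apply: spectrum_TUD => //; last by rewrite -bd.
      by move=> S bS; exact: ess_descent_TUD.
    by move=> S S' d bS bS' ud m; exact: mirror_ess_descent m.
  by split=> //; exact: sigma_RDe_qPhi.
by move=> bd; apply: sigma_BWminus_qPhi => //; rewrite -bd.
Qed.
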